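(* For every integer $a\ge4$, $$\frac{1-i^{a+1}}{\pi^a(1+i)^{a-1}}\int_0^\infty\frac{x^a\,dx}{(\cos x-\cosh x)^2}=a\sum_{n=1}^\infty\frac{n^{a-1}}{\sinh^2(n\pi)}-2\pi\sum_{n=1}^\infty\frac{n^a\cosh(n\pi)}{\sinh^3(n\pi)}.$$
   Context: $i=\sqrt{-1}$. *)

(* Defs.v *)
From Stdlib Require Export Reals.
From Coquelicot Require Export Coquelicot.

(* Main.v *)
(* Both sides are lattice sums over positive integers [m, k], and they are
   matched without contour integration.

   Integral side: with [z = exp (- (1 - i) x)] one has
   [1 / (cos x - cosh x)^2 = 4 |z / (1 - z)^2|^2 = 4 sum k l z^k conj(z)^l], and
   integrating against [x^a] gives
   [4 a! sum k l / ((1 - i) (k + i l))^(a + 1)].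
   The square partial sums are controlled by an explicit majorant whose integral
   tends to 0; this is where [4 <= a] is used.

   Series side: expanding [1 / sinh^2] and [cosh / sinh^3] in exponentials and
   summing over [n] with the Lipschitz formula
   [sum_n n^(a-1) e^(-2 pi n t) = (a-1)! / (2 pi)^a sum_{k in Z} (t + i k)^(-a)]
   leaves [- 8 a! / (2 pi)^a sum m k Im ((m + i k)^(-a-1))].
   For [a = 2] the Lipschitz formula is the partial fraction expansion of
   [1 / sinh^2], obtained by iterating the duplication formula
   [4 / sinh^2 (2 w) = 1 / sinh^2 w + 1 / sinh^2 (w + i pi / 2)]; larger [a]
   follow by differentiation in [t].

   The symmetry [k + i m = i (m - i k)] identifies the two square partial sums
   up to the constant in the theorem, for every truncation. *)

Require Import Defs.
From Stdlib Require Import Reals Lra Lia Factorial.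
From Coquelicot Require Import Coquelicot.
Open Scope R_scope.

(* Coquelicot states many equalities in carriers that only compute to [R], where [ring] fails. *)
Ltac real_eq := match goal with |- ?a = ?b => change (@eq R a b) end.

(** * Dominated convergence for series and double series *)

(** The constants of the theorem come from symmetry. Put [S = sum m k (m + i k)^(-a-1)]. Exchanging
    [m] and [k] gives [i^(a+1) S = conj S], so the factor [1 - i^(a+1)] isolates [2 i Im S]. The
    product [(1 + i)^(a-1) (1 - i)^(a+1) = - 2^a i] turns the rotation by [1 - i] on the integral
    side into a real factor. On the series side, [a] and [2 pi] are the weights for which the
    [k = 0] terms of the Lipschitz formula cancel. Squares are the truncation of choice because they
    are invariant under this exchange: the comparison is then pure algebra at each [N], and only
    limits of two real sequences remain to be identified. Existence of the integral and its
    interchange with the sum come from one estimate. The power series of [T = z / (1 - z)^2] is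
    truncated before squaring, so that [|T|^2 - |T_N|^2 = (|T| - |T_N|) (|T| + |T_N|)] inherits the
    explicit remainder of an arithmetico-geometric sum. *)

Lemma filterlim_sum_n {T : Type} (F : (T -> Prop) -> Prop) {FF : Filter F}
  (f : T -> nat -> R) (g : nat -> R) (N : nat) :
  (forall n, filterlim (fun x => f x n) F (locally (g n))) ->
  filterlim (fun x => sum_n (f x) N) F (locally (sum_n g N)).
Proof.
intros Hf. induction N as [|N IH].
- rewrite sum_O. apply filterlim_ext with (2 := Hf 0%nat). intros x; now rewrite sum_O.
- rewrite sum_Sn. apply filterlim_ext with (fun x => plus (sum_n (f x) N) (f x (S N))).
  { intros x; now rewrite sum_Sn. }
  eapply filterlim_comp_2; [exact IH|exact (Hf (S N))|].
  apply (filterlim_plus (sum_n g N : R_NormedModule) (g (S N))).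
Qed.

Lemma is_series_sum_n_Series (u : nat -> R) : ex_series u ->
  is_lim_seq (sum_n u) (Series u).
Proof. intros H. exact (Series_correct u H). Qed.

Lemma ex_series_Rle (u M : nat -> R) :
  (forall n, Rabs (u n) <= M n) -> ex_series M -> ex_series u.
Proof. intros H HM. apply (ex_series_le (V := R_CompleteNormedModule) u M H HM). Qed.

Lemma Rabs_Series_le (u M : nat -> R) :
  (forall n, Rabs (u n) <= M n) -> ex_series M -> Rabs (Series u) <= Series M.
Proof.
intros H HM.
assert (Hu : ex_series (fun n => Rabs (u n))).
{ apply ex_series_Rle with M; auto. intros n; rewrite Rabs_Rabsolu; auto. }
apply Rle_trans with (1 := Series_Rabs u Hu).
apply Series_le; auto. intros n; split; auto. apply Rabs_pos.
Qed.

Lemma Series_minus_sum_n (u M : nat -> R) (N : nat) :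
  (forall n, Rabs (u n) <= M n) -> ex_series M ->
  Rabs (Series u - sum_n u N) <= Series M - sum_n M N.
Proof.
intros H HM.
assert (Hu := ex_series_Rle u M H HM).
rewrite (Series_incr_n u (S N)); [|lia|auto].
rewrite (Series_incr_n M (S N)); [|lia|auto].
simpl Nat.pred. rewrite <- !sum_n_Reals.
replace (sum_n u N + Series (fun k => u (S N + k)%nat) - sum_n u N)
  with (Series (fun k => u (S N + k)%nat)) by ring.
replace (sum_n M N + Series (fun k => M (S N + k)%nat) - sum_n M N)
  with (Series (fun k => M (S N + k)%nat)) by ring.
apply Rabs_Series_le; auto.
now apply (ex_series_incr_n M).
Qed.

(** Beyond a common index [N] both tails are at most [eps / 4], and the finite part converges term
    by term. The filter is arbitrary because the lemma serves both sequences ([eventually]) and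
    difference quotients ([Rbar_locally' 0]). *)
Lemma tannery {T : Type} (F : (T -> Prop) -> Prop) {FF : ProperFilter F}
  (f : T -> nat -> R) (g M : nat -> R) :
  (forall n, filterlim (fun x => f x n) F (locally (g n))) ->
  ex_series M ->
  F (fun x => forall n, Rabs (f x n) <= M n) ->
  filterlim (fun x => Series (f x)) F (locally (Series g)).
Proof.
intros Hf HM Hb.
assert (Hg : forall n, Rabs (g n) <= M n).
{ intros n.
  assert (Hn := filterlim_comp _ _ _ _ Rabs _ _ _ (Hf n) (continuous_Rabs (g n))).
  apply (filterlim_le (F := F) (fun x => Rabs (f x n)) (fun _ => M n) (Rabs (g n)) (M n)).
  - apply filter_imp with (2 := Hb). intros x Hx; apply Hx.
  - exact Hn.
  - apply filterlim_const. }
apply filterlim_locally. intros eps.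
assert (He : 0 < eps / 4) by (generalize (cond_pos eps); lra).
destruct (proj2 (is_lim_seq_spec _ _) (is_series_sum_n_Series M HM) (mkposreal _ He)) as [N HN].
specialize (HN N (le_n N)). simpl in HN.
assert (Hs := filterlim_sum_n F f g N Hf).
assert (He2 : 0 < eps / 2) by (generalize (cond_pos eps); lra).
assert (Hs' := proj1 (filterlim_locally _ _) Hs (mkposreal _ He2)).
apply filter_imp with (2 := filter_and _ _ Hb Hs').
intros x [Hx Hsx].
change (Rabs (sum_n (f x) N - sum_n g N) < eps / 2) in Hsx.
change (Rabs (Series (f x) - Series g) < eps).
assert (H1 := Series_minus_sum_n (f x) M N Hx HM).
assert (H2 := Series_minus_sum_n g M N Hg HM).
rewrite Rabs_minus_sym in HN.
assert (H3 := Rle_lt_trans _ _ _ (Rle_abs _) HN).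
replace (Series (f x) - Series g) with
  ((Series (f x) - sum_n (f x) N) + (sum_n (f x) N - sum_n g N) + - (Series g - sum_n g N)) by ring.
apply Rle_lt_trans with (1 := Rabs_triang _ _).
rewrite Rabs_Ropp.
assert (H4 := Rabs_triang (Series (f x) - sum_n (f x) N) (sum_n (f x) N - sum_n g N)).
simpl in H3. lra.
Qed.

Lemma Series_finite_support (u : nat -> R) (N : nat) :
  (forall n, (N < n)%nat -> u n = 0) -> Series u = sum_n u N.
Proof.
intros H. apply is_series_unique.
change (is_lim_seq (sum_n u) (sum_n u N)).
apply (is_lim_seq_ext_loc (fun _ => sum_n u N)).
- exists N. intros n Hn. induction Hn as [|n Hn IH]; auto.
  rewrite sum_Sn, <- IH, H; [|lia]. symmetry; apply Rplus_0_r.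
- apply (is_lim_seq_const (sum_n u N)).
Qed.

Lemma Rabs_sum_n_le (u M : nat -> R) (N : nat) :
  (forall n, (n <= N)%nat -> Rabs (u n) <= M n) -> Rabs (sum_n u N) <= sum_n M N.
Proof.
induction N as [|N IH]; intros H.
- rewrite !sum_O. apply H; lia.
- rewrite !sum_Sn. apply Rle_trans with (1 := Rabs_triang _ _).
  apply Rplus_le_compat; [apply IH; intros; apply H; lia|apply H; lia].
Qed.

Lemma sum_n_le_Series (M : nat -> R) (N : nat) :
  (forall n, 0 <= M n) -> ex_series M -> sum_n M N <= Series M.
Proof.
intros H HM.
assert (Hb : forall n, Rabs (M n) <= M n) by (intros n; rewrite Rabs_pos_eq; auto; lra).
generalize (Series_minus_sum_n M M N Hb HM) (Rabs_pos (Series M - sum_n M N)). lra.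
Qed.

Section DoubleSeries.

Variables (u : nat -> nat -> R) (A B : nat -> R).
Hypothesis u_le : forall m n, Rabs (u m n) <= A m * B n.
Hypothesis A_pos : forall m, 0 <= A m.
Hypothesis B_pos : forall m, 0 <= B m.
Hypothesis ex_A : ex_series A.
Hypothesis ex_B : ex_series B.

Lemma ex_series_row (m : nat) : ex_series (u m).
Proof.
apply ex_series_Rle with (fun n => A m * B n); auto.
apply (ex_series_scal_l (K := R_AbsRing) (A m) B ex_B).
Qed.

Lemma Series_row_le (m : nat) : Rabs (Series (u m)) <= A m * Series B.
Proof.
rewrite <- Series_scal_l. apply Rabs_Series_le; auto.
apply (ex_series_scal_l (K := R_AbsRing) (A m) B ex_B).
Qed.

Lemma ex_series_double : ex_series (fun m => Series (u m)).
Proof.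
apply ex_series_Rle with (fun m => A m * Series B).
- apply Series_row_le.
- now apply ex_series_scal_r.
Qed.

(** Setting the rows beyond [N] to zero makes the square sum a single series in [m] with majorant
    [A m * Series B], to which [tannery] applies. *)
Lemma is_lim_seq_square :
  is_lim_seq (fun N => sum_n (fun m => sum_n (u m) N) N)
    (Series (fun m => Series (u m))).
Proof.
apply (is_lim_seq_ext
  (fun N => Series (fun m => if Nat.leb m N then sum_n (u m) N else 0))).
{ intros N. rewrite (Series_finite_support _ N).
  - apply sum_n_ext_loc. intros m Hm. now rewrite (proj2 (Nat.leb_le m N) Hm).
  - intros m Hm. now rewrite (proj2 (Nat.leb_gt m N) Hm). }
apply (tannery eventually (fun N m => if Nat.leb m N then sum_n (u m) N else 0)
  (fun m => Series (u m)) (fun m => A m * Series B)).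
- intros m.
  change (is_lim_seq (fun N => if Nat.leb m N then sum_n (u m) N else 0) (Series (u m))).
  apply (is_lim_seq_ext_loc (sum_n (u m))).
  + exists m. intros N HN. now rewrite (proj2 (Nat.leb_le m N) HN).
  + apply is_series_sum_n_Series, ex_series_row.
- now apply ex_series_scal_r.
- apply filter_forall. intros N m.
  assert (HB : sum_n B N <= Series B) by now apply sum_n_le_Series.
  destruct (Nat.leb m N).
  + apply Rle_trans with (sum_n (fun n => A m * B n) N).
    * apply Rabs_sum_n_le; auto.
    * change (sum_n (fun n => mult (A m) (B n)) N <= A m * Series B).
      rewrite sum_n_mult_l. apply Rmult_le_compat_l; auto.
  + rewrite Rabs_R0. apply Rmult_le_pos; auto.
    apply Rle_trans with (2 := HB). rewrite sum_n_Reals. now apply cond_pos_sum.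
Qed.

End DoubleSeries.

(** Both iterated sums are limits of the same square partial sums, since finite sums commute. *)
Lemma Series_swap (u : nat -> nat -> R) (A B : nat -> R) :
  (forall m n, Rabs (u m n) <= A m * B n) ->
  (forall m, 0 <= A m) -> (forall m, 0 <= B m) -> ex_series A -> ex_series B ->
  Series (fun m => Series (u m)) = Series (fun n => Series (fun m => u m n)).
Proof.
intros Hu HA HB eA eB.
assert (H1 := is_lim_seq_square u A B Hu HA HB eA eB).
assert (H2 : is_lim_seq (fun N => sum_n (fun n => sum_n (fun m => u m n) N) N)
    (Series (fun n => Series (fun m => u m n)))).
{ apply (is_lim_seq_square _ B A); auto. intros m n. rewrite Rmult_comm. apply Hu. }
apply is_lim_seq_unique in H1. apply is_lim_seq_unique in H2.
rewrite (Lim_seq_ext _ (fun N => sum_n (fun n => sum_n (fun m => u m n) N) N)) in H1.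
- rewrite H1 in H2. now injection H2.
- intros N. apply sum_n_switch.
Qed.

(** * Summability and termwise differentiation *)

Lemma INR_S_pos (n : nat) : 0 < INR (S n).
Proof. apply lt_0_INR; lia. Qed.

(** With [a = sqrt n] and [b = sqrt (n + 1)] one has [1 / a - 1 / b = 1 / (a b (a + b)) >= 1 / (2
    b^3)], a telescoping majorant. It controls the term of index [n + 1] by that of index [n], hence
    the dropped first term. The exponent 3/2 is what [lattice_term_le] leaves. *)
Lemma ex_series_inv_pow_3_2 : ex_series (fun n => / (INR (S n) * sqrt (INR (S n)))).
Proof.
assert (Hw : ex_series (fun n => 2 * (/ sqrt (INR (S n)) - / sqrt (INR (S (S n)))))).
{ exists (2 * (1 - 0)).
  change (is_lim_seq (sum_n (fun n => 2 * (/ sqrt (INR (S n)) - / sqrt (INR (S (S n)))))) (2 * (1 - 0))).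
  apply (is_lim_seq_ext (fun n => 2 * (1 - / sqrt (INR (S (S n)))))).
  { intros n. induction n as [|n IH].
    - rewrite sum_O. simpl (INR 1). rewrite sqrt_1, Rinv_1. reflexivity.
    - rewrite sum_Sn, <- IH. change plus with Rplus. ring. }
  apply (is_lim_seq_scal_l _ 2 (1 - 0)).
  apply is_lim_seq_minus'; [apply is_lim_seq_const|].
  apply (is_lim_seq_incr_1 (fun n => / sqrt (INR (S n)))), (is_lim_seq_incr_1 (fun n => / sqrt (INR n))).
  replace (Finite 0) with (Rbar_inv p_infty) by reflexivity.
  apply is_lim_seq_inv; [|discriminate].
  apply (filterlim_comp _ _ _ INR sqrt _ (Rbar_locally p_infty)); [apply is_lim_seq_INR|].
  apply filterlim_sqrt_p. }
apply (ex_series_incr_1 (fun n => / (INR (S n) * sqrt (INR (S n))))).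
apply ex_series_Rle with (2 := Hw). intros n.
assert (H1 := INR_S_pos n). assert (H2 := INR_S_pos (S n)).
set (a := sqrt (INR (S n))). set (b := sqrt (INR (S (S n)))).
assert (Ha : 0 < a) by now apply sqrt_lt_R0.
assert (Hb : 0 < b) by now apply sqrt_lt_R0.
assert (Ea : a * a = INR (S n)) by (apply sqrt_sqrt; lra).
assert (Eb : b * b = INR (S (S n))) by (apply sqrt_sqrt; lra).
assert (Hab : b * b = a * a + 1) by (rewrite Ea, Eb, (S_INR (S n)); lra).
assert (Hle : a <= b) by nra.
rewrite Rabs_pos_eq by (apply Rlt_le, Rinv_0_lt_compat, Rmult_lt_0_compat; auto).
rewrite <- Eb.
replace (/ a - / b) with (/ (a * b * (a + b))).
- apply Rle_trans with (2 * / (b * b * (b + b))).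
  + right. field. lra.
  + apply Rmult_le_compat_l; [lra|]. apply Rinv_le_contravar.
    * apply Rmult_lt_0_compat; nra.
    * apply Rmult_le_compat; nra.
- apply Rmult_eq_reg_l with (a * b * (a + b)).
  + rewrite Rinv_r by (apply Rgt_not_eq; apply Rmult_lt_0_compat; nra).
    transitivity (b * b - a * a); [lra|field; lra].
  + apply Rgt_not_eq; apply Rmult_lt_0_compat; nra.
Qed.

Lemma ex_series_inv_sqr : ex_series (fun n => / INR (S n) ^ 2).
Proof.
apply ex_series_Rle with (2 := ex_series_inv_pow_3_2). intros n.
assert (H : 1 <= INR (S n)) by (rewrite S_INR; generalize (pos_INR n); lra).
assert (Hs : 1 <= sqrt (INR (S n))) by (rewrite <- sqrt_1; now apply sqrt_le_1_alt).
rewrite Rabs_pos_eq by (apply Rlt_le, Rinv_0_lt_compat, pow_lt; lra).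
apply Rinv_le_contravar; [nra|].
rewrite <- Rsqr_pow2. apply Rmult_le_compat_l; [lra|].
assert (E := sqrt_sqrt (INR (S n)) ltac:(lra)). nra.
Qed.

Lemma pow_le_exp (x : R) (k : nat) : 0 <= x -> x ^ k <= INR (fact k) * exp x.
Proof.
intros Hx. assert (Hf := lt_0_INR _ (lt_O_fact k)).
assert (H : x ^ k / INR (fact k) <= exp x).
{ apply Rle_trans with (2 := exp_ge_taylor x k Hx).
  assert (Hp : forall i, 0 <= x ^ i / INR (fact i)).
  { intros i. apply Rmult_le_pos; [now apply pow_le|].
    apply Rlt_le, Rinv_0_lt_compat, lt_0_INR, lt_O_fact. }
  destruct k as [|k].
  - simpl; lra.
  - simpl sum_f_R0. assert (0 <= sum_f_R0 (fun k0 => x ^ k0 / INR (fact k0)) k) by now apply cond_pos_sum.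
    simpl in *. lra. }
apply Rmult_le_compat_l with (r := INR (fact k)) in H; [|lra].
replace (INR (fact k) * (x ^ k / INR (fact k))) with (x ^ k) in H by (field; lra). exact H.
Qed.

Lemma pow_exp_le (c x : R) (j k : nat) : 0 < c -> 0 < x ->
  x ^ j * exp (- (c * x)) <= INR (fact (j + k)) / c ^ (j + k) * / x ^ k.
Proof.
intros Hc Hx.
assert (H := pow_le_exp (c * x) (j + k) ltac:(nra)).
rewrite Rpow_mult_distr, (pow_add x) in H. rewrite exp_Ropp.
assert (He := exp_pos (c * x)).
assert (Hxk := pow_lt x k Hx). assert (Hck := pow_lt c (j + k) Hc).
apply Rmult_le_reg_r with (c ^ (j + k) * (exp (c * x) * x ^ k)).
{ apply Rmult_lt_0_compat; auto. nra. }
apply Rle_trans with (c ^ (j + k) * (x ^ j * x ^ k)); [right; field; lra|].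
apply Rle_trans with (1 := H). right; field; lra.
Qed.

Lemma ex_series_pow_exp (c : R) (j : nat) : 0 < c ->
  ex_series (fun n => INR (S n) ^ j * exp (- (c * INR (S n)))).
Proof.
intros Hc.
apply ex_series_Rle with (fun n => INR (fact (j + 2)) / c ^ (j + 2) * / INR (S n) ^ 2).
- intros n. assert (H := INR_S_pos n). rewrite Rabs_pos_eq.
  + now apply pow_exp_le.
  + apply Rmult_le_pos; [apply pow_le; lra|apply Rlt_le, exp_pos].
- apply (ex_series_scal_l (K := R_AbsRing) _ _ ex_series_inv_sqr).
Qed.

(** The mean value theorem bounds every difference quotient by [M n], so [tannery] applies as [h]
    tends to 0. The gap between [t0] and [t] keeps [t + h] in the domain of the bound; the
    applications take [t0 = t / 2]. *)
Lemma is_derive_Series (u v : nat -> R -> R) (M : nat -> R) (t0 t : R) :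
  t0 < t ->
  (forall n x, t0 < x -> is_derive (u n) x (v n x)) ->
  (forall n x, t0 < x -> Rabs (v n x) <= M n) ->
  ex_series M ->
  (forall x, t0 < x -> ex_series (fun n => u n x)) ->
  is_derive (fun x => Series (fun n => u n x)) t (Series (fun n => v n t)).
Proof.
intros Ht Hd Hv HM Hu.
assert (Hlim : filterlim (fun h => Series (fun n => (u n (t + h) - u n t) / h))
  (Rbar_locally' (Finite 0)) (locally (Series (fun n => v n t)))).
{ apply (tannery (Rbar_locally' (Finite 0)) (fun h n => (u n (t + h) - u n t) / h)
    (fun n => v n t) M).
  - intros n. apply filterlim_locally. intros eps.
    destruct (proj1 (is_derive_Reals _ _ _) (Hd n t Ht) eps (cond_pos eps)) as [d Hdel].
    exists d. intros h Hh Hh0. apply Hdel; auto.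
    change (Rabs (h - 0) < d) in Hh. now rewrite Rminus_0_r in Hh.
  - exact HM.
  - assert (Hp : 0 < t - t0) by lra.
    exists (mkposreal _ Hp). intros h Hh Hh0 n.
    change (Rabs (h - 0) < t - t0) in Hh. rewrite Rminus_0_r in Hh.
    apply Rabs_def2 in Hh.
    destruct (MVT_gen (u n) t (t + h) (v n)) as [c [Hc Ec]].
    + intros x Hx. apply Hd.
      apply Rlt_trans with (2 := proj1 Hx). apply Rmin_glb_lt; lra.
    + intros x Hx. apply continuity_pt_filterlim.
      apply (ex_derive_continuous (u n) x). exists (v n x). apply Hd.
      apply Rlt_le_trans with (2 := proj1 Hx). apply Rmin_glb_lt; lra.
    + rewrite Ec. replace (v n c * (t + h - t) / h) with (v n c) by (field; auto).
      apply Hv. apply Rlt_le_trans with (2 := proj1 Hc). apply Rmin_glb_lt; lra. }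
apply is_derive_Reals. intros eps Heps.
destruct (proj1 (filterlim_locally _ _) Hlim (mkposreal _ Heps)) as [d Hdel].
assert (Hm : 0 < Rmin d (t - t0)) by (apply Rmin_glb_lt; [apply cond_pos|lra]).
exists (mkposreal _ Hm). intros h Hh0 Hh. simpl in Hh.
assert (Hh1 := Rlt_le_trans _ _ _ Hh (Rmin_l _ _)).
assert (Hh2 := Rlt_le_trans _ _ _ Hh (Rmin_r _ _)).
apply Rabs_def2 in Hh2.
specialize (Hdel h). simpl in Hdel.
change (ball 0 d h) with (Rabs (h - 0) < d) in Hdel. rewrite Rminus_0_r in Hdel.
specialize (Hdel Hh1 Hh0).
rewrite <- Series_minus by (apply Hu; lra).
unfold Rdiv. rewrite <- Series_scal_r. exact Hdel.
Qed.

Lemma is_lim_seq_div_derive (f : R -> R) (l : R) (h : nat -> R) :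
  is_derive f 0 l -> f 0 = 0 -> (forall n, h n <> 0) -> is_lim_seq h 0 ->
  is_lim_seq (fun n => f (h n) / h n) l.
Proof.
intros Hd H0 Hh Hl. apply is_lim_seq_spec. intros eps.
destruct (proj1 (is_derive_Reals _ _ _) Hd eps (cond_pos eps)) as [d Hdel].
destruct (proj2 (is_lim_seq_spec _ _) Hl d) as [N HN].
exists N. intros n Hn. specialize (HN n Hn). rewrite Rminus_0_r in HN.
specialize (Hdel (h n) (Hh n) HN). now rewrite Rplus_0_l, H0, Rminus_0_r in Hdel.
Qed.

(** * Partial fractions of the squared hyperbolic cosecant *)

Lemma cosh_sqr (x : R) : cosh x ^ 2 = 1 + sinh x ^ 2.
Proof.
unfold cosh, sinh. rewrite exp_Ropp. field. apply Rgt_not_eq, exp_pos.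
Qed.

Lemma sinh_2 (x : R) : sinh (2 * x) = 2 * sinh x * cosh x.
Proof.
unfold cosh, sinh. replace (- (2 * x)) with (- x + - x) by ring.
replace (2 * x) with (x + x) by ring. rewrite !exp_plus, exp_Ropp. field. apply Rgt_not_eq, exp_pos.
Qed.

Lemma cosh_2 (x : R) : cosh (2 * x) = 1 + 2 * sinh x ^ 2.
Proof.
unfold cosh, sinh. replace (- (2 * x)) with (- x + - x) by ring.
replace (2 * x) with (x + x) by ring. rewrite !exp_plus, exp_Ropp. field. apply Rgt_not_eq, exp_pos.
Qed.

Lemma sinh_pos (x : R) : 0 < x -> 0 < sinh x.
Proof. intros H. rewrite <- sinh_0. now apply sinh_lt. Qed.

Lemma cosh_ge_1 (x : R) : 1 <= cosh x.
Proof.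
assert (H := cosh_sqr x). assert (0 < cosh x); [|nra].
unfold cosh. generalize (exp_pos x) (exp_pos (- x)). lra.
Qed.

(* [Re (1 / sinh^2 (x + i y))] *)
Definition re_csch2 (x y : R) : R :=
  (sinh x ^ 2 * cos y ^ 2 - cosh x ^ 2 * sin y ^ 2) / (sinh x ^ 2 + sin y ^ 2) ^ 2.

Lemma sin_sqr (y : R) : sin y ^ 2 = 1 - cos y ^ 2.
Proof. generalize (sin2_cos2 y). unfold Rsqr. lra. Qed.

Lemma re_csch2_duplication (x y : R) : 0 < x ->
  re_csch2 (2 * x) (2 * y) = (re_csch2 x y + re_csch2 x (y + PI / 2)) / 4.
Proof.
intros Hx. unfold re_csch2.
replace (sin (y + PI / 2)) with (cos y) by (rewrite <- cos_shift, <- cos_neg; f_equal; ring).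
replace (cos (y + PI / 2)) with (- sin y) by (rewrite <- sin_shift, <- sin_neg; f_equal; ring).
rewrite sinh_2, cosh_2, sin_2a, cos_2a_sin.
assert (Hs := sinh_pos x Hx).
replace ((2 * sinh x * cosh x) ^ 2) with (4 * sinh x ^ 2 * (1 + sinh x ^ 2))
  by (rewrite <- cosh_sqr; ring).
replace ((2 * sin y * cos y) ^ 2) with (4 * (1 - cos y ^ 2) * cos y ^ 2)
  by (rewrite <- sin_sqr; ring).
replace ((1 - 2 * sin y * sin y) ^ 2) with ((1 - 2 * sin y ^ 2) ^ 2) by ring.
replace ((- sin y) ^ 2) with (sin y ^ 2) by ring.
rewrite cosh_sqr, sin_sqr.
assert (HA : 0 < sinh x ^ 2) by (apply pow_lt; lra).
assert (HB : 0 <= cos y ^ 2) by apply pow2_ge_0.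
assert (HB1 : 0 <= sin y ^ 2) by apply pow2_ge_0.
rewrite sin_sqr in HB1.
replace ((1 + 2 * sinh x ^ 2) ^ 2) with (1 + 4 * sinh x ^ 2 * (1 + sinh x ^ 2)) by ring.
set (A := sinh x ^ 2) in *. set (B := cos y ^ 2) in *.
(* This is [|sinh (2 w)|^2 = 4 |sinh w|^2 |cosh w|^2] for [w = x + i y], where
   [|cosh w|^2 = A + B]. *)
replace (4 * A * (1 + A) + 4 * (1 - B) * B) with (4 * (A + (1 - B)) * (A + B)) by ring.
field. nra.
Qed.

(** It folds the ordinates above [PI / 2] back, so that every nonzero sample point of
    [re_csch2_iterated] stays in [(0, PI / 2]], where [sin_ge_third] gives a bound. *)
Lemma re_csch2_reflection (x y : R) : re_csch2 x (PI - y) = re_csch2 x y.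
Proof.
unfold re_csch2. rewrite sin_PI_x.
replace (cos (PI - y)) with (- cos y).
- replace ((- cos y) ^ 2) with (cos y ^ 2) by ring. reflexivity.
- rewrite <- (cos_neg (PI - y)). replace (- (PI - y)) with (y - PI) by ring.
  rewrite cos_minus, cos_PI, sin_PI. ring.
Qed.

(** The induction grows the interval symmetrically about its centre [M]. Up to reflection, [j] and
    [2 M - j] are the two points that one duplication produces from the point [j] of the coarser
    grid. *)
Lemma sum_n_m_reflection (f : nat -> R) (M : nat) : (1 <= M)%nat ->
  sum_n_m f 1 (2 * M - 1) =
  f M + sum_n_m (fun j => f j + f (2 * M - j)%nat) 1 (M - 1).
Proof.
intros HM.
assert (H : forall p, (p < M)%nat ->
  sum_n_m f (M - p) (M + p) =
  f M + sum_n_m (fun j => f j + f (2 * M - j)%nat) (M - p) (M - 1)).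
{ induction p as [|p IH]; intros Hp.
  - rewrite Nat.add_0_r, Nat.sub_0_r, sum_n_n, sum_n_m_zero by lia.
    symmetry; apply Rplus_0_r.
  - rewrite (sum_Sn_m _ (M - S p)) by lia.
    replace (M + S p)%nat with (S (M + p)) by lia.
    rewrite sum_n_Sm by lia.
    rewrite (sum_Sn_m _ (M - S p) (M - 1)) by lia.
    replace (S (M - S p)) with (M - p)%nat by lia.
    rewrite IH by lia.
    replace (2 * M - (M - S p))%nat with (S (M + p)) by lia.
    change plus with Rplus. cbv beta.
    real_eq. ring. }
specialize (H (M - 1)%nat ltac:(lia)).
replace (M - (M - 1))%nat with 1%nat in H by lia.
now replace (M + (M - 1))%nat with (2 * M - 1)%nat in H by lia.
Qed.

(** After [n + 1] duplications the ordinates are the multiples of [PI / 2 ^ (n + 1)] modulo [PI].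
    Reflection pairs them, whence the factor 2; only [0] and [PI / 2] are their own mirror
    images. *)
Lemma re_csch2_iterated (n : nat) (x : R) : 0 < x ->
  re_csch2 (2 * x) 0 =
  / 4 * (/ 4 ^ n) * (re_csch2 (x / 2 ^ n) 0 + re_csch2 (x / 2 ^ n) (PI / 2) +
    2 * sum_n_m (fun j => re_csch2 (x / 2 ^ n) (INR j * PI / 2 ^ (S n))) 1 (2 ^ n - 1)).
Proof.
intros Hx. induction n as [|n IH].
- simpl (2 ^ 0 - 1)%nat. rewrite sum_n_m_zero by lia. rewrite !pow_O.
  replace (2 * x) with (2 * (x / 1)) by field.
  replace (re_csch2 (2 * (x / 1)) 0) with (re_csch2 (2 * (x / 1)) (2 * 0)) by (f_equal; ring).
  rewrite re_csch2_duplication by (unfold Rdiv; rewrite Rinv_1; lra).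
  rewrite Rplus_0_l. change zero with 0. field.
- rewrite IH. clear IH.
  assert (H2 := pow_lt 2 n ltac:(lra)). assert (H4 := pow_lt 4 n ltac:(lra)).
  set (z := x / 2 ^ S n).
  assert (Hz : 0 < z).
  { apply Rdiv_lt_0_compat; auto. apply pow_lt; lra. }
  assert (Ez : x / 2 ^ n = 2 * z) by (unfold z; simpl; field; lra).
  rewrite Ez. set (M := (2 ^ n)%nat).
  assert (HM : (1 <= M)%nat) by (unfold M; generalize (Nat.pow_nonzero 2 n); lia).
  replace (2 ^ S n - 1)%nat with (2 * M - 1)%nat by (unfold M; simpl; lia).
  rewrite (sum_n_m_reflection _ M HM).
  assert (EM : INR M = 2 ^ n) by (unfold M; rewrite pow_INR; reflexivity).
  replace (re_csch2 (2 * z) 0) with (re_csch2 (2 * z) (2 * 0)) by (f_equal; ring).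
  rewrite re_csch2_duplication, Rplus_0_l by auto.
  replace (re_csch2 (2 * z) (PI / 2)) with (re_csch2 (2 * z) (2 * (PI / 4))) by (f_equal; field).
  rewrite re_csch2_duplication by auto.
  (* The old endpoint [PI / 2] yields the value at [PI / 4] twice; that point is the centre [j = M]
     of the finer grid. *)
  replace (PI / 4 + PI / 2) with (PI - PI / 4) by field. rewrite re_csch2_reflection.
  replace (INR M * PI / 2 ^ S (S n)) with (PI / 4) by (rewrite EM; simpl; field; lra).
  rewrite (sum_n_m_ext_loc _
    (fun j => mult (/ 4) (re_csch2 z (INR j * PI / 2 ^ S (S n)) +
               re_csch2 z (INR (2 * M - j) * PI / 2 ^ S (S n))))).
  + rewrite sum_n_m_mult_l. change mult with Rmult.
    change (4 ^ S n) with (4 * 4 ^ n).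
    match goal with |- _ = _ * (_ + 2 * (_ + ?s)) => set (T := s) end.
    match goal with |- _ * (_ + 2 * (/ 4 * ?s)) = _ => change s with T end.
    field. lra.
  + intros j Hj.
    replace (INR j * PI / 2 ^ S n) with (2 * (INR j * PI / 2 ^ S (S n))) by (simpl; field; lra).
    rewrite re_csch2_duplication by auto.
    rewrite minus_INR, mult_INR, EM by lia.
    replace ((INR 2 * 2 ^ n - INR j) * PI / 2 ^ S (S n)) with
      (PI - (INR j * PI / 2 ^ S (S n) + PI / 2)) by (simpl; field; lra).
    rewrite re_csch2_reflection. unfold mult; simpl. field.
Qed.

(** A crude Jordan inequality: for [y <= 2] the first two Taylor terms already satisfy
    [y - y^3 / 6 >= y / 3]. *)
Lemma sin_ge_third (y : R) : 0 <= y <= PI / 2 -> y / 3 <= sin y.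
Proof.
intros Hy. assert (HP := PI_4).
assert (H := proj1 (SIN y ltac:(lra) ltac:(lra))).
apply Rle_trans with (2 := H). unfold sin_lb, sin_approx, sum_f_R0, sin_term. simpl.
assert (H2 : y <= 2) by lra. assert (H0 : 0 <= y) by lra.
assert (E : y * y <= 4) by nra.
assert (H3 : 0 <= y * (y * y)) by nra.
match goal with |- _ <= ?t =>
  replace t with (y - y * (y * y) / 6 + y * (y * y) * (y * y) * (42 - y * y) / 5040) by field end.
assert (0 <= y * (y * y) * (y * y) * (42 - y * y)).
{ apply Rmult_le_pos; [|lra]. apply Rmult_le_pos; nra. }
nra.
Qed.

(** The modulus of [1 / sinh^2 (x + i y)] is [1 / (sinh x ^ 2 + sin y ^ 2)], at most
    [1 / sin y ^ 2]. The bound is free of [x], as domination along the iteration requires. *)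
Lemma Rabs_re_csch2_le (x y : R) : 0 < y <= PI / 2 -> Rabs (re_csch2 x y) <= 9 / y ^ 2.
Proof.
intros Hy. assert (Hs := sin_ge_third y ltac:(lra)).
assert (Hs2 : y ^ 2 / 9 <= sin y ^ 2) by nra.
assert (Hy2 : 0 < y ^ 2) by (apply pow_lt; lra).
assert (HA := pow2_ge_0 (sinh x)).
unfold re_csch2. set (D := sinh x ^ 2 + sin y ^ 2).
assert (HD : 0 < D) by (unfold D; lra).
apply Rle_trans with (/ D).
- unfold Rdiv. rewrite Rabs_mult, (Rabs_pos_eq (/ D ^ 2)) by (apply Rlt_le, Rinv_0_lt_compat, pow_lt; auto).
  replace (/ D) with (D * / D ^ 2) by (field; lra).
  apply Rmult_le_compat_r; [apply Rlt_le, Rinv_0_lt_compat, pow_lt; auto|].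
  rewrite cosh_sqr. unfold D. assert (HB := sin_sqr y). assert (HC := pow2_ge_0 (cos y)).
  apply Rabs_le. nra.
- replace (9 / y ^ 2) with (/ (y ^ 2 / 9)) by (field; lra).
  apply Rinv_le_contravar; [lra|]. unfold D; lra.
Qed.

Lemma is_lim_seq_inv_pow2 : is_lim_seq (fun n => / 2 ^ n) 0.
Proof.
apply (is_lim_seq_ext (fun n => (/ 2) ^ n)).
- intros n. now rewrite pow_inv.
- apply is_lim_seq_geom. rewrite Rabs_pos_eq; lra.
Qed.

(** With [h = 2^(-n)] and [w = x + i c], this is the real part of [h^2 / sinh^2 (h w)] tending to
    [1 / w^2]. *)
Lemma is_lim_seq_re_csch2 (x c : R) : 0 < x ->
  is_lim_seq (fun n => / 4 ^ n * re_csch2 (x / 2 ^ n) (c / 2 ^ n))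
    ((x ^ 2 - c ^ 2) / (x ^ 2 + c ^ 2) ^ 2).
Proof.
intros Hx.
assert (Hh : forall n, / 2 ^ n <> 0).
{ intros n. apply Rinv_neq_0_compat, pow_nonzero. lra. }
assert (Hs : is_lim_seq (fun n => sinh (x * / 2 ^ n) / / 2 ^ n) x).
{ apply (is_lim_seq_div_derive (fun h => sinh (x * h)) x (fun n => / 2 ^ n)); auto.
  - unfold sinh. auto_derive; [easy|]. rewrite Rmult_0_r, Ropp_0, exp_0. field.
  - now rewrite Rmult_0_r, sinh_0.
  - apply is_lim_seq_inv_pow2. }
assert (Ht : is_lim_seq (fun n => sin (c * / 2 ^ n) / / 2 ^ n) c).
{ apply (is_lim_seq_div_derive (fun h => sin (c * h)) c (fun n => / 2 ^ n)); auto.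
  - auto_derive; [easy|]. rewrite Rmult_0_r, cos_0. ring.
  - now rewrite Rmult_0_r, sin_0.
  - apply is_lim_seq_inv_pow2. }
assert (Hxh : forall d, is_lim_seq (fun n => d * / 2 ^ n) 0).
{ intros d. rewrite <- (Rmult_0_r d). apply (is_lim_seq_scal_l _ d 0), is_lim_seq_inv_pow2. }
assert (Hc : is_lim_seq (fun n => cos (c * / 2 ^ n)) 1).
{ rewrite <- cos_0. apply (is_lim_seq_continuous cos); [|apply Hxh].
  apply continuity_cos. }
assert (Hd : is_lim_seq (fun n => cosh (x * / 2 ^ n)) 1).
{ rewrite <- cosh_0. apply (is_lim_seq_continuous cosh); [|apply Hxh].
  apply derivable_continuous_pt, derivable_pt_cosh. }
apply (is_lim_seq_ext (fun n =>
  ((sinh (x * / 2 ^ n) / / 2 ^ n) ^ 2 * cos (c * / 2 ^ n) ^ 2 -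
    cosh (x * / 2 ^ n) ^ 2 * (sin (c * / 2 ^ n) / / 2 ^ n) ^ 2) /
  ((sinh (x * / 2 ^ n) / / 2 ^ n) ^ 2 + (sin (c * / 2 ^ n) / / 2 ^ n) ^ 2) ^ 2)).
- intros n. unfold re_csch2. fold (Rdiv x (2 ^ n)) (Rdiv c (2 ^ n)).
  assert (H2 := pow_lt 2 n ltac:(lra)).
  assert (E4 : 4 ^ n = 2 ^ n * 2 ^ n) by (rewrite <- Rpow_mult_distr; f_equal; lra).
  rewrite E4.
  assert (HS : 0 < sinh (x / 2 ^ n)) by (apply sinh_pos, Rdiv_lt_0_compat; auto).
  assert (HQ : sinh (x / 2 ^ n) ^ 2 + sin (c / 2 ^ n) ^ 2 <> 0).
  { apply Rgt_not_eq. generalize (pow2_ge_0 (sin (c / 2 ^ n))) (pow_lt _ 2 HS). lra. }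
  field. split; [exact HQ|split; [lra|]].
  rewrite !Rpow_mult_distr, <- Rmult_plus_distr_r.
  apply Rmult_integral_contrapositive_currified; [exact HQ|]. apply pow_nonzero; lra.
- assert (P2 : forall u l, is_lim_seq u (Finite l) -> is_lim_seq (fun n => u n ^ 2) (Finite (l ^ 2))).
  { intros u l Hu. simpl. apply is_lim_seq_mult'; auto. apply is_lim_seq_mult'; auto.
    apply is_lim_seq_const. }
  replace ((x ^ 2 - c ^ 2) / (x ^ 2 + c ^ 2) ^ 2)
    with ((x ^ 2 * 1 ^ 2 - 1 ^ 2 * c ^ 2) / (x ^ 2 + c ^ 2) ^ 2) by (f_equal; ring).
  apply is_lim_seq_div'.
  + apply is_lim_seq_minus'; apply is_lim_seq_mult'; auto.
  + apply P2, is_lim_seq_plus'; auto.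
  + apply Rgt_not_eq, pow_lt. generalize (pow_lt x 2 Hx) (pow2_ge_0 c); lra.
Qed.

Lemma csch2_partial_fractions (t : R) : 0 < t ->
  PI ^ 2 / sinh (PI * t) ^ 2 =
  / t ^ 2 + 2 * Series (fun k => (t ^ 2 - INR (S k) ^ 2) / (t ^ 2 + INR (S k) ^ 2) ^ 2).
Proof.
intros Ht. assert (HP := PI_RGT_0).
set (x := PI * t / 2). assert (Hx : 0 < x) by (unfold x; nra).
(* [f n k] is the interior term [j = k + 1] of [re_csch2_iterated], extended by zero so that
   [Series (f n)] is a finite sum; [w] is its termwise limit. *)
pose (f := fun n k => if Nat.leb (S k) (2 ^ n - 1) then
   / 4 ^ n * re_csch2 (x / 2 ^ n) (INR (S k) * PI / 2 / 2 ^ n) else 0).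
pose (w := fun k => (x ^ 2 - (INR (S k) * PI / 2) ^ 2) / (x ^ 2 + (INR (S k) * PI / 2) ^ 2) ^ 2).
assert (Hpow : forall n k, (S k <= 2 ^ n - 1)%nat -> INR (S k) < 2 ^ n).
{ intros n k Hk. replace (2 ^ n) with (INR (2 ^ n)) by (rewrite pow_INR; reflexivity).
  apply lt_INR. lia. }
assert (Hlim : is_lim_seq (fun n => Series (f n)) (Series w)).
(* Since [4 ^ n = (2 ^ n)^2], the bound [9 / y ^ 2] becomes [36 / (PI (k + 1))^2] for every [n], and
   [PI >= 3] gives the constant 4. *)
{ apply (tannery eventually f w (fun k => 4 * / INR (S k) ^ 2)).
  - intros k.
    change (is_lim_seq (fun n => f n k) (w k)).
    apply is_lim_seq_ext_loc with (fun n => / 4 ^ n * re_csch2 (x / 2 ^ n) (INR (S k) * PI / 2 / 2 ^ n)).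
    + exists (S (S k)). intros n Hn. unfold f. rewrite (proj2 (Nat.leb_le _ _)); [reflexivity|].
      generalize (Nat.pow_gt_lin_r 2 n). lia.
    + now apply is_lim_seq_re_csch2.
  - apply (ex_series_scal_l (K := R_AbsRing) 4 _ ex_series_inv_sqr).
  - apply filter_forall. intros n k. unfold f.
    assert (Hk := INR_S_pos k). assert (H2 := pow_lt 2 n ltac:(lra)).
    assert (H4 := pow_lt 4 n ltac:(lra)).
    assert (Hk2 := pow_lt _ 2 Hk).
    destruct (Nat.leb_spec (S k) (2 ^ n - 1)) as [H|H].
    + specialize (Hpow n k H).
      rewrite Rabs_mult, Rabs_pos_eq by (apply Rlt_le, Rinv_0_lt_compat; auto).
      assert (Hy : 0 < INR (S k) * PI / 2 / 2 ^ n <= PI / 2).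
      { split.
        - apply Rdiv_lt_0_compat; auto. nra.
        - apply Rmult_le_reg_r with (2 ^ n); auto. unfold Rdiv. rewrite (Rmult_assoc _ (/ 2 ^ n)), Rinv_l; nra. }
      apply Rle_trans with (/ 4 ^ n * (9 / (INR (S k) * PI / 2 / 2 ^ n) ^ 2)).
      { apply Rmult_le_compat_l; [apply Rlt_le, Rinv_0_lt_compat; auto|]. now apply Rabs_re_csch2_le. }
      assert (E4 : 4 ^ n = 2 ^ n * 2 ^ n) by (rewrite <- Rpow_mult_distr; f_equal; lra).
      rewrite E4.
      replace (/ (2 ^ n * 2 ^ n) * (9 / (INR (S k) * PI / 2 / 2 ^ n) ^ 2))
        with (36 / (PI ^ 2) * / INR (S k) ^ 2) by (field; lra).
      apply Rmult_le_compat_r; [apply Rlt_le, Rinv_0_lt_compat; auto|].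
      assert (3 <= PI) by (generalize PI2_3_2; lra).
      apply Rmult_le_reg_r with (PI ^ 2); [apply pow_lt; auto|].
      unfold Rdiv. rewrite Rmult_assoc, Rinv_l by (apply pow_nonzero; lra). nra.
    + rewrite Rabs_R0. apply Rmult_le_pos; [lra|apply Rlt_le, Rinv_0_lt_compat; auto]. }
assert (Hf : forall n, Series (f n) = / 4 ^ n *
   sum_n_m (fun j => re_csch2 (x / 2 ^ n) (INR j * PI / 2 ^ (S n))) 1 (2 ^ n - 1)).
{ intros n. rewrite (Series_finite_support _ (2 ^ n)).
  2:{ intros k Hk. unfold f. rewrite (proj2 (Nat.leb_gt _ _)); [reflexivity|lia]. }
  assert (H2 := pow_lt 2 n ltac:(lra)).
  rewrite <- (sum_n_m_mult_l (K := R_AbsRing)). unfold sum_n.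
  assert (H2n := Nat.pow_nonzero 2 n ltac:(lia)).
  destruct (Nat.eq_dec (2 ^ n - 1) 0) as [E|E].
  - rewrite (sum_n_m_zero _ 1) by lia.
    rewrite (sum_n_m_ext_loc _ (fun _ => zero)), sum_n_m_const_zero; [reflexivity|].
    intros k Hk. unfold f. rewrite (proj2 (Nat.leb_gt _ _)); [reflexivity|lia].
  - rewrite (sum_n_m_Chasles _ 0 (2 ^ n - 2)) by lia.
    rewrite (sum_n_m_ext_loc _ (fun _ => zero) (S (2 ^ n - 2))), sum_n_m_const_zero.
    2:{ intros k Hk. unfold f. rewrite (proj2 (Nat.leb_gt _ _)); [reflexivity|lia]. }
    rewrite plus_zero_r.
    replace (2 ^ n - 1)%nat with (S (2 ^ n - 2)) by lia. rewrite <- (sum_n_m_S _ 0).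
    apply sum_n_m_ext_loc. intros k Hk. unfold f.
    rewrite (proj2 (Nat.leb_le _ _)) by lia.
    change mult with Rmult. do 2 f_equal. simpl. field. lra. }
(* Of the two endpoints, [0] contributes [1 / x ^ 2] in the limit, while the value at [PI / 2] stays
   bounded and is killed by [/ 4 ^ n]. *)
assert (Hall : is_lim_seq (fun n =>
  / 4 * (/ 4 ^ n * re_csch2 (x / 2 ^ n) (0 / 2 ^ n) +
   / 4 ^ n * re_csch2 (x / 2 ^ n) (PI / 2) + 2 * Series (f n)))
  (/ 4 * ((x ^ 2 - 0 ^ 2) / (x ^ 2 + 0 ^ 2) ^ 2 + 0 + 2 * Series w))).
{ apply is_lim_seq_mult'; [apply is_lim_seq_const|].
  apply is_lim_seq_plus'; [apply is_lim_seq_plus'|].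
  - now apply is_lim_seq_re_csch2.
  - apply is_lim_seq_abs_0.
    apply is_lim_seq_le_le with (fun _ => 0) (fun n => (/ 4) ^ n * (9 / (PI / 2) ^ 2)).
    + intros n. split; [apply Rabs_pos|].
      assert (H4 := pow_lt 4 n ltac:(lra)).
      rewrite Rabs_mult, Rabs_pos_eq, pow_inv by (apply Rlt_le, Rinv_0_lt_compat; auto).
      apply Rmult_le_compat_l; [apply Rlt_le, Rinv_0_lt_compat; auto|].
      apply Rabs_re_csch2_le. lra.
    + apply is_lim_seq_const.
    + rewrite <- (Rmult_0_l (9 / (PI / 2) ^ 2)).
      apply is_lim_seq_mult'; [|apply is_lim_seq_const].
      apply is_lim_seq_geom. rewrite Rabs_pos_eq; lra.
  - apply is_lim_seq_mult'; [apply is_lim_seq_const|exact Hlim]. }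
apply is_lim_seq_ext with (v := fun _ => re_csch2 (2 * x) 0) in Hall.
2:{ intros n. rewrite (re_csch2_iterated n x Hx), Hf.
  replace (0 / 2 ^ n) with 0 by (unfold Rdiv; ring). ring. }
apply is_lim_seq_unique in Hall. rewrite Lim_seq_const in Hall.
injection Hall as Hall.
unfold re_csch2 in Hall. rewrite sin_0, cos_0 in Hall.
assert (Hs : 0 < sinh (2 * x)) by (apply sinh_pos; lra).
replace ((sinh (2 * x) ^ 2 * 1 ^ 2 - cosh (2 * x) ^ 2 * 0 ^ 2) / (sinh (2 * x) ^ 2 + 0 ^ 2) ^ 2)
  with (/ sinh (2 * x) ^ 2) in Hall by (field; lra).
replace (PI * t) with (2 * x) by (unfold x; field).
unfold Rdiv at 1. rewrite Hall.
replace (Series w) with (4 / PI ^ 2 *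
  Series (fun k => (t ^ 2 - INR (S k) ^ 2) / (t ^ 2 + INR (S k) ^ 2) ^ 2)).
- unfold x. field. lra.
- rewrite <- Series_scal_l. apply Series_ext. intros k. unfold w, x.
  assert (Hk := INR_S_pos k).
  assert (H1 := pow_lt (PI * t) 2 ltac:(nra)).
  assert (H2 := pow_lt (INR (S k) * PI) 2 ltac:(nra)).
  assert (H3 := pow_lt t 2 Ht). assert (H4 := pow_lt _ 2 Hk).
  field. lra.
Qed.

(** * The Lipschitz summation formula *)

Section GeometricSums.

Variable c : R.
Hypothesis c_pos : 0 < c.

Lemma exp_shift (n : nat) : exp (- (c * INR (S (S n)))) = exp (- c) * exp (- (c * INR (S n))).
Proof. rewrite <- exp_plus. f_equal. rewrite (S_INR (S n)). ring. Qed.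

Lemma exp_neg_lt_1 : exp (- c) < 1.
Proof. rewrite <- exp_0. apply exp_increasing. lra. Qed.

(** Here and in the next two lemmas an index shift gives a linear equation for the sum, solvable
    because [exp (- c) < 1]. *)
Lemma Series_pow_exp_0 : Series (fun n => exp (- (c * INR (S n)))) = exp (- c) / (1 - exp (- c)).
Proof.
assert (H := ex_series_pow_exp c 0 c_pos). assert (Hr := exp_neg_lt_1).
apply (ex_series_ext _ (fun n => exp (- (c * INR (S n))))) in H.
2:{ intros n. cbn [pow]. apply Rmult_1_l. }
assert (Hs := Series_incr_1 _ H). cbv beta in Hs.
rewrite (Series_ext (fun k => exp (- (c * INR (S (S k)))))
  (fun k => exp (- c) * exp (- (c * INR (S k))))), Series_scal_l in Hs by apply exp_shift.
replace (exp (- (c * INR 1))) with (exp (- c)) in Hs by (f_equal; simpl; ring).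
apply Rmult_eq_reg_r with (1 - exp (- c)); [|lra].
unfold Rdiv. rewrite Rmult_assoc, Rinv_l; lra.
Qed.

Lemma Series_pow_exp_1 : Series (fun n => INR (S n) * exp (- (c * INR (S n)))) =
  exp (- c) / (1 - exp (- c)) ^ 2.
Proof.
assert (H := ex_series_pow_exp c 1 c_pos). assert (Hr := exp_neg_lt_1).
assert (H0 := ex_series_pow_exp c 0 c_pos).
apply (ex_series_ext _ (fun n => exp (- (c * INR (S n))))) in H0.
2:{ intros n. cbn [pow]. apply Rmult_1_l. }
apply (ex_series_ext _ (fun n => INR (S n) * exp (- (c * INR (S n))))) in H.
2:{ intros n. now rewrite pow_1. }
assert (Hs := Series_incr_1 _ H). cbv beta in Hs.
rewrite (Series_ext (fun k => INR (S (S k)) * exp (- (c * INR (S (S k)))))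
  (fun k => exp (- c) * (INR (S k) * exp (- (c * INR (S k))) + exp (- (c * INR (S k)))))) in Hs.
2:{ intros n. rewrite exp_shift, (S_INR (S n)). ring. }
rewrite Series_scal_l, Series_plus, Series_pow_exp_0 in Hs; auto.
replace (INR 1 * exp (- (c * INR 1))) with (exp (- c)) in Hs by (simpl INR; rewrite Rmult_1_l; f_equal; ring).
set (S1 := Series _) in *. set (r := exp (- c)) in *.
apply Rmult_eq_reg_r with (1 - r); [|lra].
transitivity (S1 - r * S1); [ring|]. rewrite Hs at 1. field. lra.
Qed.

Lemma Series_pow_exp_2 : Series (fun n => INR (S n) ^ 2 * exp (- (c * INR (S n)))) =
  exp (- c) * (1 + exp (- c)) / (1 - exp (- c)) ^ 3.
Proof.
assert (H := ex_series_pow_exp c 2 c_pos). assert (Hr := exp_neg_lt_1).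
assert (H0 := ex_series_pow_exp c 0 c_pos).
apply (ex_series_ext _ (fun n => exp (- (c * INR (S n))))) in H0.
2:{ intros n. cbn [pow]. apply Rmult_1_l. }
assert (H1 := ex_series_pow_exp c 1 c_pos).
apply (ex_series_ext _ (fun n => INR (S n) * exp (- (c * INR (S n))))) in H1.
2:{ intros n. now rewrite pow_1. }
assert (Hs := Series_incr_1 _ H). cbv beta in Hs.
rewrite (Series_ext (fun k => INR (S (S k)) ^ 2 * exp (- (c * INR (S (S k)))))
  (fun k => exp (- c) * (INR (S k) ^ 2 * exp (- (c * INR (S k))) +
     (2 * (INR (S k) * exp (- (c * INR (S k)))) + exp (- (c * INR (S k))))))) in Hs.
2:{ intros n. rewrite exp_shift, (S_INR (S n)). ring. }
assert (H2 := ex_series_scal_l (K := R_AbsRing) 2 _ H1).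
rewrite Series_scal_l, Series_plus, Series_plus, Series_scal_l, Series_pow_exp_0, Series_pow_exp_1 in Hs; auto.
2:{ apply (ex_series_plus (V := R_NormedModule) _ _ H2 H0). }
replace (INR 1 ^ 2 * exp (- (c * INR 1))) with (exp (- c)) in Hs
  by (simpl INR; rewrite pow1, Rmult_1_l; f_equal; ring).
set (S1 := Series _) in *. set (r := exp (- c)) in *.
apply Rmult_eq_reg_r with (1 - r); [|lra].
transitivity (S1 - r * S1); [ring|]. rewrite Hs at 1. field. lra.
Qed.

End GeometricSums.

Lemma exp_neg_2_sinh (y : R) : 1 - exp (- (2 * y)) = 2 * sinh y * exp (- y).
Proof.
unfold sinh. replace (- (2 * y)) with (- y + - y) by ring.
rewrite exp_plus, exp_Ropp. field. apply Rgt_not_eq, exp_pos.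
Qed.

Lemma csch2_series (y : R) : 0 < y ->
  Series (fun n => INR (S n) * exp (- (2 * y * INR (S n)))) = / (4 * sinh y ^ 2).
Proof.
intros Hy. rewrite Series_pow_exp_1 by lra. rewrite exp_neg_2_sinh.
assert (Hs := sinh_pos y Hy). assert (He := exp_pos (- y)).
replace (- (2 * y)) with (- y + - y) by ring. rewrite exp_plus. field. lra.
Qed.

Lemma cosh_csch3_series (y : R) : 0 < y ->
  Series (fun n => INR (S n) ^ 2 * exp (- (2 * y * INR (S n)))) = cosh y / (4 * sinh y ^ 3).
Proof.
intros Hy. rewrite Series_pow_exp_2 by lra. rewrite exp_neg_2_sinh.
assert (Hs := sinh_pos y Hy). assert (He := exp_pos (- y)).
replace (1 + exp (- (2 * y))) with (2 * cosh y * exp (- y)).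
2:{ unfold cosh. replace (- (2 * y)) with (- y + - y) by ring.
  rewrite exp_plus, exp_Ropp. field. apply Rgt_not_eq, exp_pos. }
replace (- (2 * y)) with (- y + - y) by ring. rewrite exp_plus. field. lra.
Qed.

(* [(t + i k)^(-n)] *)
Definition ipow (t k : R) (n : nat) : C := ((/ (t, k)) ^ n)%C.

Lemma ipow_S_Re (t k : R) (n : nat) : 0 < t ->
  Re (ipow t k (S n)) = (t * Re (ipow t k n) + k * Im (ipow t k n)) / (t ^ 2 + k ^ 2).
Proof.
intros Ht. unfold ipow. rewrite Cpow_S. destruct ((/ (t, k)) ^ n)%C as [p q].
simpl. field. nra.
Qed.

Lemma ipow_S_Im (t k : R) (n : nat) : 0 < t ->
  Im (ipow t k (S n)) = (t * Im (ipow t k n) - k * Re (ipow t k n)) / (t ^ 2 + k ^ 2).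
Proof.
intros Ht. unfold ipow. rewrite Cpow_S. destruct ((/ (t, k)) ^ n)%C as [p q].
simpl. field. nra.
Qed.

Lemma is_derive_div_sqr_norm (p q : R -> R) (dp dq k t : R) : 0 < t ->
  is_derive p t dp -> is_derive q t dq ->
  is_derive (fun x => (x * p x + k * q x) / (x ^ 2 + k ^ 2)) t
    ((p t + t * dp + k * dq) / (t ^ 2 + k ^ 2) -
     2 * t * (t * p t + k * q t) / (t ^ 2 + k ^ 2) ^ 2).
Proof.
intros Ht Hp Hq. assert (HD : t ^ 2 + k ^ 2 <> 0) by nra.
auto_derive.
- repeat split; auto; [eexists; exact Hp|eexists; exact Hq].
- change (t * (t * 1) + k * (k * 1)) with (t ^ 2 + k ^ 2).
  rewrite (is_derive_unique (fun x : R => p x) t _ Hp), (is_derive_unique (fun x : R => q x) t _ Hq). field. exact HD.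
Qed.

(** Real and imaginary parts go through one induction because the recurrences [ipow_S_Re] and
    [ipow_S_Im] couple them. *)
Lemma is_derive_ipow (k t : R) (n : nat) : 0 < t ->
  is_derive (fun t => Re (ipow t k n)) t (- INR n * Re (ipow t k (S n))) /\
  is_derive (fun t => Im (ipow t k n)) t (- INR n * Im (ipow t k (S n))).
Proof.
intros Ht. induction n as [|n [IR II]].
- simpl INR. rewrite Ropp_0, !Rmult_0_l.
  split; [exact (is_derive_const 1 t)|exact (is_derive_const 0 t)].
- assert (HP : locally t (fun x => 0 < x)).
  { exists (mkposreal t Ht). intros x Hx. apply Rabs_def2 in Hx.
    unfold minus, plus, opp in Hx; simpl in Hx. lra. }
  assert (HD : t ^ 2 + k ^ 2 <> 0) by nra.
  assert (R2 := ipow_S_Re t k (S n) Ht). assert (I2 := ipow_S_Im t k (S n) Ht).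
  assert (R1 := ipow_S_Re t k n Ht). assert (I1 := ipow_S_Im t k n Ht).
  split.
  + apply is_derive_ext_loc with
      (fun t => (t * Re (ipow t k n) + k * Im (ipow t k n)) / (t ^ 2 + k ^ 2)).
    { apply filter_imp with (2 := HP). intros x Hx. now rewrite ipow_S_Re. }
    evar_last; [exact (is_derive_div_sqr_norm _ _ _ _ k t Ht IR II)|].
    cbv beta. rewrite R2, R1, I1, S_INR. field. exact HD.
  + apply is_derive_ext_loc with
      (fun t => (t * Im (ipow t k n) + k * (- Re (ipow t k n))) / (t ^ 2 + k ^ 2)).
    { apply filter_imp with (2 := HP). intros x Hx. rewrite ipow_S_Im by auto. f_equal. ring. }
    assert (IR' := is_derive_opp _ _ _ IR).
    evar_last; [exact (is_derive_div_sqr_norm _ _ _ _ k t Ht II IR')|].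
    cbv beta. change opp with Ropp. rewrite I2, R1, I1, S_INR. field. exact HD.
Qed.

Lemma Cmod_ge_Im (x y : R) : Rabs y <= Cmod (x, y).
Proof.
unfold Cmod. simpl fst; simpl snd. rewrite <- sqrt_Rsqr_abs.
apply sqrt_le_1_alt. unfold Rsqr. nra.
Qed.

Lemma Re_le_Cmod (z : C) : Rabs (Re z) <= Cmod z.
Proof. apply Rle_trans with (2 := Rmax_Cmod z). apply Rmax_l. Qed.

Lemma Im_le_Cmod (z : C) : Rabs (Im z) <= Cmod z.
Proof. apply Rle_trans with (2 := Rmax_Cmod z). apply Rmax_r. Qed.

Lemma pair_neq_0 (t k : R) : 0 < t -> (t, k) <> RtoC 0.
Proof. intros Ht H. injection H. lra. Qed.

Lemma Cmod_ipow (t k : R) (n : nat) : 0 < t -> Cmod (ipow t k n) = / Cmod (t, k) ^ n.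
Proof.
intros Ht. unfold ipow. rewrite Cmod_pow, Cmod_inv by now apply pair_neq_0.
apply pow_inv.
Qed.

(** The bound does not involve [t], so it can serve as the majorant when the series over [k] is
    differentiated in [t]. *)
Lemma Cmod_ipow_le (t k : R) (n : nat) : 0 < t -> 1 <= k -> (2 <= n)%nat ->
  Cmod (ipow t k n) <= / k ^ 2.
Proof.
intros Ht Hk Hn. rewrite Cmod_ipow by auto.
assert (H := Cmod_ge_Im t k). rewrite Rabs_pos_eq in H by lra.
apply Rinv_le_contravar; [apply pow_lt; lra|].
apply Rle_trans with (Cmod (t, k) ^ 2).
- apply pow_incr; lra.
- apply Rle_pow; auto; lra.
Qed.

Lemma INR_S_ge_1 (n : nat) : 1 <= INR (S n).
Proof. rewrite S_INR. generalize (pos_INR n). lra. Qed.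

Lemma ex_series_ipow (t : R) (n : nat) : 0 < t -> (2 <= n)%nat ->
  ex_series (fun k => Re (ipow t (INR (S k)) n)).
Proof.
intros Ht Hn. apply ex_series_Rle with (2 := ex_series_inv_sqr). intros k.
apply Rle_trans with (1 := Re_le_Cmod _). apply Cmod_ipow_le; auto. apply INR_S_ge_1.
Qed.

(** The sum over all integers [k] is folded: [k] and [- k] give conjugate terms, hence twice the
    real part, and [k = 0] stands apart. Differentiation multiplies the exponential side by
    [- 2 PI (n + 1)] and the other side by [- (j + 2)], which accounts for the factorial and the
    power of [2 PI]. *)
Lemma lipschitz_formula (j : nat) (t : R) : 0 < t ->
  Series (fun n => INR (S n) ^ S j * exp (- (2 * PI * t * INR (S n)))) =
  INR (fact (S j)) / (2 * PI) ^ S (S j) *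
  (Re (ipow t 0 (S (S j))) + 2 * Series (fun k => Re (ipow t (INR (S k)) (S (S j))))).
Proof.
assert (HP := PI_RGT_0). revert t. induction j as [|j IH]; intros t Ht.
- assert (H2 : forall k, Re (ipow t k 2) = (t ^ 2 - k ^ 2) / (t ^ 2 + k ^ 2) ^ 2).
  { intros k. rewrite ipow_S_Re, ipow_S_Re, ipow_S_Im by auto.
    unfold ipow; simpl. field. nra. }
  rewrite H2, (Series_ext (fun k => Re (ipow t (INR (S k)) 2)) _ (fun k => H2 _)).
  rewrite (Series_ext _ (fun n => INR (S n) * exp (- (2 * (PI * t) * INR (S n))))).
  2:{ intros n. rewrite pow_1. do 3 f_equal. ring. }
  rewrite csch2_series by nra.
  replace ((t ^ 2 - 0 ^ 2) / (t ^ 2 + 0 ^ 2) ^ 2) with (/ t ^ 2) by (field; lra).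
  rewrite <- csch2_partial_fractions by auto.
  assert (Hs := sinh_pos (PI * t) ltac:(nra)). simpl fact. simpl INR. field. lra.
- assert (HL : is_derive (fun t => Series (fun n => INR (S n) ^ S j * exp (- (2 * PI * t * INR (S n))))) t
    (Series (fun n => - (2 * PI) * (INR (S n) ^ S (S j) * exp (- (2 * PI * t * INR (S n))))))).
  { apply (is_derive_Series (fun n t => INR (S n) ^ S j * exp (- (2 * PI * t * INR (S n))))
     (fun n t => - (2 * PI) * (INR (S n) ^ S (S j) * exp (- (2 * PI * t * INR (S n)))))
     (fun n => 2 * PI * (INR (S n) ^ S (S j) * exp (- (2 * PI * (t / 2) * INR (S n))))) (t / 2)).
    - lra.
    - intros n x Hx. generalize (INR (S n)). intros b.
      auto_derive; auto. cbn [pow]. ring.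
    - intros n x Hx. assert (Hn := INR_S_pos n).
      rewrite Rabs_mult, Rabs_Ropp, Rabs_pos_eq by lra.
      rewrite Rabs_pos_eq by (apply Rmult_le_pos; [apply pow_le; lra|apply Rlt_le, exp_pos]).
      apply Rmult_le_compat_l; [lra|]. apply Rmult_le_compat_l; [apply pow_le; lra|].
      assert (Hxn : 2 * PI * (t / 2) * INR (S n) < 2 * PI * x * INR (S n)).
      { apply Rmult_lt_compat_r; auto. nra. }
      apply Rlt_le, exp_increasing. lra.
    - apply (ex_series_scal_l (K := R_AbsRing) (V := R_NormedModule) (2 * PI)).
      apply (ex_series_pow_exp (2 * PI * (t / 2))). nra.
    - intros x Hx. apply (ex_series_pow_exp (2 * PI * x)). nra. }
  assert (HR : is_derive (fun t => INR (fact (S j)) / (2 * PI) ^ S (S j) *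
     (Re (ipow t 0 (S (S j))) + 2 * Series (fun k => Re (ipow t (INR (S k)) (S (S j)))))) t
     (INR (fact (S j)) / (2 * PI) ^ S (S j) *
     (- INR (S (S j)) * Re (ipow t 0 (S (S (S j)))) +
      2 * Series (fun k => - INR (S (S j)) * Re (ipow t (INR (S k)) (S (S (S j)))))))).
  { apply is_derive_scal.
    apply (is_derive_plus (V := R_NormedModule)).
    - now apply is_derive_ipow.
    - apply is_derive_scal.
      apply (is_derive_Series (fun k t => Re (ipow t (INR (S k)) (S (S j))))
        (fun k t => - INR (S (S j)) * Re (ipow t (INR (S k)) (S (S (S j)))))
        (fun k => INR (S (S j)) * / INR (S k) ^ 2) (t / 2)).
      + lra.
      + intros k x Hx. apply is_derive_ipow. lra.
      + intros k x Hx. rewrite Rabs_mult, Rabs_Ropp, Rabs_pos_eq by apply pos_INR.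
        apply Rmult_le_compat_l; [apply pos_INR|].
        apply Rle_trans with (1 := Re_le_Cmod _). apply Cmod_ipow_le; [lra|apply INR_S_ge_1|lia].
      + apply (ex_series_scal_l (K := R_AbsRing) _ _ ex_series_inv_sqr).
      + intros x Hx. apply ex_series_ipow; [lra|lia]. }
  apply is_derive_unique in HL. apply is_derive_unique in HR.
  (* The induction hypothesis holds on the whole ball of radius [t] about [t], so both sides have
     the same derivative at [t]. *)
  rewrite (Derive_ext_loc _ (fun t => INR (fact (S j)) / (2 * PI) ^ S (S j) *
     (Re (ipow t 0 (S (S j))) + 2 * Series (fun k => Re (ipow t (INR (S k)) (S (S j)))))) t) in HL.
  2:{ exists (mkposreal t Ht). intros x Hx. apply IH. apply Rabs_def2 in Hx.
    unfold minus, plus, opp in Hx; simpl in Hx. lra. }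
  apply (eq_trans (eq_sym HR)) in HL. rewrite !Series_scal_l in HL.
  apply Rmult_eq_reg_l with (- (2 * PI)); [|lra].
  rewrite <- HL. rewrite (fact_simpl (S j)), mult_INR.
  change ((2 * PI) ^ S (S (S j))) with (2 * PI * (2 * PI) ^ S (S j)).
  assert (Hp := pow_lt (2 * PI) (S (S j)) ltac:(lra)).
  field. lra.
Qed.

(** * The hyperbolic series as a lattice sum *)

(** The common summand of both hyperbolic series, with [q = 1] for [1 / sinh^2] and [q = 2] for
    [cosh / sinh^3]. Transposition exchanges [p] and [q], which makes the inner sum a Lipschitz
    sum. *)
Definition bi_exp (p q n m : nat) : R :=
  INR (S n) ^ p * INR (S m) ^ q * exp (- (2 * PI * INR (S m) * INR (S n))).

(* [2 m n >= m + n] for positive integers, so the exponential splits. *)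
Lemma bi_exp_le (p q n m : nat) : Rabs (bi_exp p q n m) <=
  (INR (S n) ^ p * exp (- (PI * INR (S n)))) * (INR (S m) ^ q * exp (- (PI * INR (S m)))).
Proof.
assert (Hn := INR_S_ge_1 n). assert (Hm := INR_S_ge_1 m). assert (HP := PI_RGT_0).
assert (Hpn : 0 <= INR (S n) ^ p) by (apply pow_le; lra).
assert (Hpm : 0 <= INR (S m) ^ q) by (apply pow_le; lra).
unfold bi_exp. rewrite Rabs_pos_eq.
2:{ apply Rmult_le_pos; [now apply Rmult_le_pos|apply Rlt_le, exp_pos]. }
replace (INR (S n) ^ p * exp (- (PI * INR (S n))) * (INR (S m) ^ q * exp (- (PI * INR (S m)))))
  with (INR (S n) ^ p * INR (S m) ^ q * exp (- (PI * INR (S n)) + - (PI * INR (S m))))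
  by (rewrite exp_plus; ring).
apply Rmult_le_compat_l; [now apply Rmult_le_pos|].
set (x := INR (S n)) in *. set (y := INR (S m)) in *.
assert (H : x + y <= 2 * y * x) by nra.
assert (H' : PI * (x + y) <= PI * (2 * y * x)) by (apply Rmult_le_compat_l; lra).
destruct (Rle_lt_or_eq_dec (- (2 * PI * y * x)) (- (PI * x) + - (PI * y))) as [Hl|He].
- lra.
- now apply Rlt_le, exp_increasing.
- rewrite He. apply Rle_refl.
Qed.

Lemma pow_exp_pos (p n : nat) : 0 <= INR (S n) ^ p * exp (- (PI * INR (S n))).
Proof.
apply Rmult_le_pos; [apply pow_le, pos_INR|apply Rlt_le, exp_pos].
Qed.

Lemma ex_series_bi_exp (p q : nat) : ex_series (fun n => Series (bi_exp p q n)).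
Proof.
apply (ex_series_double _ _ _ (bi_exp_le p q));
  apply ex_series_pow_exp, PI_RGT_0.
Qed.

Lemma Series_bi_exp_swap (p q : nat) :
  Series (fun n => Series (bi_exp p q n)) = Series (fun m => Series (bi_exp q p m)).
Proof.
rewrite (Series_swap _ _ _ (bi_exp_le p q) (pow_exp_pos p) (pow_exp_pos q)
  (ex_series_pow_exp PI p PI_RGT_0) (ex_series_pow_exp PI q PI_RGT_0)).
apply Series_ext. intros m. apply Series_ext. intros n. unfold bi_exp.
rewrite (Rmult_comm (INR (S n) ^ p)). f_equal. f_equal. ring.
Qed.

Lemma csch2_term (p n : nat) :
  INR (S n) ^ p / sinh (INR (S n) * PI) ^ 2 = 4 * Series (bi_exp p 1 n).
Proof.
assert (Hn := INR_S_pos n). assert (HP := PI_RGT_0).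
assert (Hx : 0 < INR (S n) * PI) by nra. assert (Hs := sinh_pos _ Hx).
rewrite (Series_ext _ (fun m => INR (S n) ^ p *
  (INR (S m) * exp (- (2 * (INR (S n) * PI) * INR (S m)))))).
- rewrite Series_scal_l, csch2_series by auto. field. lra.
- intros m. unfold bi_exp. rewrite pow_1, Rmult_assoc. do 4 f_equal. ring.
Qed.

Lemma cosh_csch3_term (p n : nat) :
  INR (S n) ^ p * cosh (INR (S n) * PI) / sinh (INR (S n) * PI) ^ 3 = 4 * Series (bi_exp p 2 n).
Proof.
assert (Hn := INR_S_pos n). assert (HP := PI_RGT_0).
assert (Hx : 0 < INR (S n) * PI) by nra. assert (Hs := sinh_pos _ Hx).
rewrite (Series_ext _ (fun m => INR (S n) ^ p *
  (INR (S m) ^ 2 * exp (- (2 * (INR (S n) * PI) * INR (S m)))))).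
- rewrite Series_scal_l, cosh_csch3_series by auto. field. lra.
- intros m. unfold bi_exp. rewrite Rmult_assoc. do 4 f_equal. ring.
Qed.

Lemma ex_series_csch2 (p : nat) :
  ex_series (fun k => INR (S k) ^ p / sinh (INR (S k) * PI) ^ 2).
Proof.
apply ex_series_ext with (fun k => 4 * Series (bi_exp p 1 k)).
- intros n. now rewrite csch2_term.
- apply (ex_series_scal_l (K := R_AbsRing) (V := R_NormedModule) 4), ex_series_bi_exp.
Qed.

Lemma ex_series_cosh_csch3 (p : nat) :
  ex_series (fun k => INR (S k) ^ p * cosh (INR (S k) * PI) / sinh (INR (S k) * PI) ^ 3).
Proof.
apply ex_series_ext with (fun k => 4 * Series (bi_exp p 2 k)).
- intros n. now rewrite cosh_csch3_term.
- apply (ex_series_scal_l (K := R_AbsRing) (V := R_NormedModule) 4), ex_series_bi_exp.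
Qed.

Lemma Series_bi_exp_inner (j q m : nat) :
  Series (bi_exp q (S j) m) = INR (S m) ^ q * (INR (fact (S j)) / (2 * PI) ^ S (S j) *
  (Re (ipow (INR (S m)) 0 (S (S j))) +
   2 * Series (fun k => Re (ipow (INR (S m)) (INR (S k)) (S (S j)))))).
Proof.
rewrite <- lipschitz_formula by apply INR_S_pos. rewrite <- Series_scal_l.
apply Series_ext. intros n. unfold bi_exp. rewrite Rmult_assoc. do 4 f_equal. ring.
Qed.

Lemma ipow_pred_Re (t k : R) (n : nat) : 0 < t ->
  Re (ipow t k n) = t * Re (ipow t k (S n)) - k * Im (ipow t k (S n)).
Proof.
intros Ht. rewrite ipow_S_Re, ipow_S_Im by auto. field. nra.
Qed.

(** After the Lipschitz formula the two sides differ by multiples of [Re (w^a) - m Re (w^(a+1))]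
    with [w = 1 / (m + i k)] and [a = j + 2]. As [w^a = (m + i k) w^(a+1)], this equals
    [- k Im (w^(a+1))], which also vanishes at [k = 0]. *)
Lemma hyperbolic_series_lattice (j : nat) :
  INR (S (S j)) * Series (fun k => INR (S k) ^ S j / sinh (INR (S k) * PI) ^ 2) -
  2 * PI * Series (fun k => INR (S k) ^ S (S j) * cosh (INR (S k) * PI) / sinh (INR (S k) * PI) ^ 3) =
  - 8 * INR (fact (S (S j))) / (2 * PI) ^ S (S j) *
  Series (fun m => Series (fun k =>
    INR (S m) * INR (S k) * Im (ipow (INR (S m)) (INR (S k)) (S (S (S j)))))).
Proof.
assert (HP := PI_RGT_0).
rewrite (Series_ext _ _ (csch2_term _)), (Series_ext _ _ (cosh_csch3_term _)).
rewrite !Series_scal_l, (Series_bi_exp_swap (S j)), (Series_bi_exp_swap (S (S j))).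
rewrite <- !Series_scal_l, <- Series_minus.
- apply Series_ext. intros m. rewrite !Series_bi_exp_inner.
  set (t := INR (S m)). assert (Ht : 0 < t) by apply INR_S_pos.
  rewrite (Series_ext (fun k => t * INR (S k) * Im (ipow t (INR (S k)) (S (S (S j)))))
    (fun k => t * (t * Re (ipow t (INR (S k)) (S (S (S j)))) - Re (ipow t (INR (S k)) (S (S j)))))).
  2:{ intros k. rewrite (ipow_pred_Re t _ (S (S j))) by auto. ring. }
  rewrite Series_scal_l, Series_minus, Series_scal_l.
  2:{ apply (ex_series_scal_l (K := R_AbsRing) (V := R_NormedModule) t), ex_series_ipow; auto; lia. }
  2:{ apply ex_series_ipow; auto; lia. }
  rewrite (ipow_pred_Re t 0 (S (S j))) by auto.
  rewrite (fact_simpl (S j)), mult_INR.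
  change ((2 * PI) ^ S (S (S j))) with (2 * PI * (2 * PI) ^ S (S j)).
  assert (Hp := pow_lt (2 * PI) (S (S j)) ltac:(lra)).
  set (Q := (2 * PI) ^ S (S j)) in *. field. lra.
- apply (ex_series_scal_l (K := R_AbsRing) (V := R_NormedModule)).
  apply (ex_series_scal_l (K := R_AbsRing) (V := R_NormedModule)), ex_series_bi_exp.
- apply (ex_series_scal_l (K := R_AbsRing) (V := R_NormedModule)).
  apply (ex_series_scal_l (K := R_AbsRing) (V := R_NormedModule)), ex_series_bi_exp.
Qed.

(* AM-GM: [|m + i k|^2 >= 2 m k], so for [n >= 5] the lattice terms are at most [(m k)^(-3/2)]. *)
Lemma lattice_term_le (m k n : nat) : (5 <= n)%nat ->
  Rabs (INR (S m) * INR (S k) * Im (ipow (INR (S m)) (INR (S k)) n)) <=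
  / (INR (S m) * sqrt (INR (S m))) * / (INR (S k) * sqrt (INR (S k))).
Proof.
intros Hn.
assert (Hx := INR_S_ge_1 m). assert (Hy := INR_S_ge_1 k).
set (x := INR (S m)) in *. set (y := INR (S k)) in *.
assert (Hxy : 0 < x * y) by nra.
rewrite Rabs_mult, (Rabs_pos_eq (x * y)) by lra.
set (s := sqrt (x * y)).
assert (Hs : s * s = x * y) by (apply sqrt_sqrt; lra).
assert (Hs0 : 0 < s) by now apply sqrt_lt_R0.
assert (Hs1 : 1 <= s) by nra.
assert (Hc : s <= Cmod (x, y)).
{ unfold Cmod, s. simpl fst; simpl snd. apply sqrt_le_1_alt. nra. }
replace (/ (x * sqrt x) * / (y * sqrt y)) with (/ s ^ 3).
2:{ rewrite <- Rinv_mult. f_equal.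
  replace (x * sqrt x * (y * sqrt y)) with (x * y * (sqrt x * sqrt y)) by ring.
  rewrite <- sqrt_mult by lra. fold s. rewrite <- Hs. ring. }
apply Rle_trans with (x * y * / s ^ 5).
- apply Rmult_le_compat_l; [lra|].
  apply Rle_trans with (1 := Im_le_Cmod _). rewrite Cmod_ipow by lra.
  apply Rinv_le_contravar; [now apply pow_lt|].
  apply Rle_trans with (Cmod (x, y) ^ 5).
  + apply pow_incr; lra.
  + apply Rle_pow; [lra|auto].
- right. rewrite <- Hs. field. lra.
Qed.

Lemma is_lim_seq_lattice (n : nat) : (5 <= n)%nat ->
  is_lim_seq (fun N => sum_n (fun m => sum_n (fun k =>
     INR (S m) * INR (S k) * Im (ipow (INR (S m)) (INR (S k)) n)) N) N)
   (Series (fun m => Series (fun k =>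
     INR (S m) * INR (S k) * Im (ipow (INR (S m)) (INR (S k)) n)))).
Proof.
intros Hn.
assert (Hp : forall m, 0 <= / (INR (S m) * sqrt (INR (S m)))).
{ intros m. apply Rlt_le, Rinv_0_lt_compat, Rmult_lt_0_compat; [|apply sqrt_lt_R0]; apply INR_S_pos. }
apply (is_lim_seq_square
  (fun m k => INR (S m) * INR (S k) * Im (ipow (INR (S m)) (INR (S k)) n)) _ _
  (fun m k => lattice_term_le m k n Hn) Hp Hp ex_series_inv_pow_3_2 ex_series_inv_pow_3_2).
Qed.

(** * Improper integrals on the half-line *)

Lemma near_positive_interval : filter_prod (at_right 0) (Rbar_locally p_infty)
  (fun ab : R * R => 0 < fst ab <= snd ab).
Proof.
apply Filter_prod with (fun u => 0 < u < 1) (fun v => 1 < v).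
- exists (mkposreal 1 Rlt_0_1). intros u Hu H0. split; auto.
  apply Rabs_def2 in Hu. unfold minus, plus, opp in Hu; simpl in Hu. lra.
- now exists 1.
- intros u v Hu Hv. simpl. lra.
Qed.

Section DominatedIntegrals.

Variables (f : R -> R) (h e : nat -> R -> R) (I E : nat -> R).
Hypothesis f_cont : forall x, 0 < x -> continuous f x.
Hypothesis f_close : forall N x, 0 < x -> Rabs (f x - h N x) <= e N x.
Hypothesis h_int : forall N, is_RInt_gen (h N) (at_right 0) (Rbar_locally p_infty) (I N).
Hypothesis e_int : forall N, is_RInt_gen (e N) (at_right 0) (Rbar_locally p_infty) (E N).
Hypothesis E_lim : is_lim_seq E 0.

(** Convergence of the integral of [f] is a conclusion. Comparison through [f] gives
    [|I N - I M| <= E N + E M], so [I] is Cauchy; then one fixed [N] controls the integral of [f]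
    over all large intervals. *)
Lemma is_RInt_gen_of_approximations : exists L,
  is_RInt_gen f (at_right 0) (Rbar_locally p_infty) L /\ is_lim_seq I L.
Proof.
assert (HC : forall N M, Rabs (I N - I M) <= E N + E M).
{ intros N M.
  apply (RInt_gen_norm (Fa := at_right 0) (Fb := Rbar_locally p_infty)
    (fun x => minus (h N x) (h M x)) (fun x => plus (e N x) (e M x))).
  - apply filter_imp with (2 := near_positive_interval). intros ab H; apply H.
  - apply filter_imp with (2 := near_positive_interval). intros ab H x Hx.
    assert (Hx0 : 0 < x) by lra.
    assert (H1 := f_close N x Hx0). assert (H2 := f_close M x Hx0).
    change (Rabs (h N x - h M x) <= e N x + e M x).
    replace (h N x - h M x) with (- (f x - h N x) + (f x - h M x)) by ring.
    apply Rle_trans with (1 := Rabs_triang _ _). rewrite Rabs_Ropp. lra.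
  - apply (is_RInt_gen_minus (V := R_NormedModule)); auto.
  - apply (is_RInt_gen_plus (V := R_NormedModule)); auto. }
assert (HL : ex_finite_lim_seq I).
{ apply ex_lim_seq_cauchy_corr. intros eps.
  assert (He : 0 < eps / 2) by (generalize (cond_pos eps); lra).
  destruct (proj2 (is_lim_seq_spec _ _) E_lim (mkposreal _ He)) as [N HN].
  exists N. intros n m Hn Hm. simpl in HN.
  assert (H1 := HN n Hn). assert (H2 := HN m Hm). rewrite Rminus_0_r in H1, H2.
  apply Rle_lt_trans with (1 := HC n m).
  apply Rabs_def2 in H1. apply Rabs_def2 in H2. lra. }
destruct HL as [L HL]. exists L. split; auto.
intros P [eps HP].
(* Four errors below [eps / 5] add up: [E N], [ye - E N], [yh - I N] and [I N - L]. *)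
assert (He : 0 < eps / 5) by (generalize (cond_pos eps); lra).
destruct (proj2 (is_lim_seq_spec _ _) E_lim (mkposreal _ He)) as [N1 HN1].
destruct (proj2 (is_lim_seq_spec _ _) HL (mkposreal _ He)) as [N2 HN2].
set (N := Nat.max N1 N2).
assert (H1 := HN1 N (Nat.le_max_l _ _)). assert (H2 := HN2 N (Nat.le_max_r _ _)).
simpl in H1, H2. rewrite Rminus_0_r in H1.
assert (Hh := h_int N (fun y => Rabs (y - I N) < eps / 5)
   (locally_ball (I N) (mkposreal _ He))).
assert (Hee := e_int N (fun y => Rabs (y - E N) < eps / 5)
   (locally_ball (E N) (mkposreal _ He))).
unfold filtermapi in Hh, Hee.
apply filter_imp with (2 := filter_and _ _ near_positive_interval (filter_and _ _ Hh Hee)).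
intros [u v] [Huv [[yh [Hyh Byh]] [ye [Hye Bye]]]]. simpl in *.
assert (Hf : ex_RInt f u v).
{ apply (ex_RInt_continuous (V := R_CompleteNormedModule)). intros x Hx. apply f_cont.
  rewrite Rmin_left in Hx by lra. lra. }
destruct Hf as [yf Hyf]. exists yf. split; auto. apply HP.
assert (Hd : Rabs (yf - yh) <= ye).
{ apply (norm_RInt_le (V := R_NormedModule) (fun x => minus (f x) (h N x)) (e N) u v); try lra.
  - intros x Hx. apply f_close. lra.
  - apply (is_RInt_minus (V := R_NormedModule)); auto.
  - auto. }
change (Rabs (yf - L) < eps).
apply Rabs_def2 in H1. apply Rabs_def2 in H2. apply Rabs_def2 in Byh. apply Rabs_def2 in Bye.
apply Rabs_le_between in Hd. apply Rabs_def1; lra.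
Qed.

End DominatedIntegrals.

(** * Laplace integrals of powers times trigonometric functions *)

Lemma is_RInt_gen_antiderivative (F f : R -> R) (l : R) :
  (forall x, is_derive F x (f x)) -> (forall x, continuous f x) ->
  is_lim F p_infty l ->
  is_RInt_gen f (at_right 0) (Rbar_locally p_infty) (l - F 0).
Proof.
intros HF Hc Hl.
apply (is_RInt_gen_ext (V := R_NormedModule) (Derive F)).
- apply filter_forall. intros ab x Hx. now apply is_derive_unique.
- apply is_RInt_gen_Derive.
  + apply filter_forall. intros ab x Hx. eexists; apply HF.
  + apply filter_forall. intros ab x Hx.
    apply continuous_ext with f; auto. intros y. symmetry. now apply is_derive_unique.
  + eapply filterlim_filter_le_1; [apply filter_le_within|].
    apply (ex_derive_continuous F). eexists; apply HF.
  + exact Hl.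
Qed.

Lemma is_lim_pow_exp (a : nat) (p : R) : 0 < p ->
  is_lim (fun x => x ^ a * exp (- (p * x))) p_infty 0.
Proof.
intros Hp.
apply (is_lim_le_le_loc (fun _ => 0) (fun x => INR (fact (a + 1)) / p ^ (a + 1) * / x)).
- exists 0. intros x Hx. split.
  + apply Rmult_le_pos; [apply pow_le; lra|apply Rlt_le, exp_pos].
  + rewrite <- (pow_1 x) at 3. now apply pow_exp_le.
- apply is_lim_const.
- rewrite <- (Rmult_0_r (INR (fact (a + 1)) / p ^ (a + 1))).
  apply (is_lim_scal_l (fun x => / x) _ p_infty 0).
  apply (is_lim_inv (fun x => x) p_infty p_infty); [apply is_lim_id|discriminate].
Qed.

Lemma is_lim_pow_exp_bounded (a : nat) (p : R) (g : R -> R) : 0 < p ->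
  (forall x, Rabs (g x) <= 1) ->
  is_lim (fun x => x ^ a * exp (- (p * x)) * g x) p_infty 0.
Proof.
intros Hp Hg.
assert (HL := is_lim_pow_exp a p Hp).
apply (is_lim_le_le_loc (fun x => - (x ^ a * exp (- (p * x)))) (fun x => x ^ a * exp (- (p * x)))); auto.
- exists 0. intros x Hx. apply Rabs_le_between. rewrite Rabs_mult.
  assert (H : 0 <= x ^ a * exp (- (p * x))).
  { apply Rmult_le_pos; [apply pow_le; lra|apply Rlt_le, exp_pos]. }
  rewrite (Rabs_pos_eq _ H). rewrite <- (Rmult_1_r (x ^ a * exp (- (p * x)))) at 2.
  apply Rmult_le_compat_l; auto.
- rewrite <- Ropp_0. apply (is_lim_opp _ p_infty 0 HL).
Qed.

Lemma Rabs_cos_le (x : R) : Rabs (cos x) <= 1.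
Proof. apply Rabs_le. apply COS_bound. Qed.

Lemma Rabs_sin_le (x : R) : Rabs (sin x) <= 1.
Proof. apply Rabs_le. apply SIN_bound. Qed.

(* [U + i V] is an antiderivative of [x^a exp (- (p + i q) x)], built by integration by parts. *)
Lemma laplace_antiderivative (a : nat) (p q : R) : 0 < p -> exists U V : R -> R,
  (forall x, is_derive U x (x ^ a * exp (- (p * x)) * cos (q * x))) /\
  (forall x, is_derive V x (- (x ^ a * exp (- (p * x)) * sin (q * x)))) /\
  U 0 = - (INR (fact a) * Re (ipow p q (S a))) /\
  V 0 = - (INR (fact a) * Im (ipow p q (S a))) /\
  is_lim U p_infty 0 /\ is_lim V p_infty 0.
Proof.
intros Hp. assert (HD : p ^ 2 + q ^ 2 <> 0) by nra.
assert (Hlc : forall n, is_lim (fun x => x ^ n * exp (- (p * x)) * cos (q * x)) p_infty 0).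
{ intros n. apply (is_lim_pow_exp_bounded n p (fun x => cos (q * x))); auto.
  intros x; apply Rabs_cos_le. }
assert (Hls : forall n, is_lim (fun x => x ^ n * exp (- (p * x)) * sin (q * x)) p_infty 0).
{ intros n. apply (is_lim_pow_exp_bounded n p (fun x => sin (q * x))); auto.
  intros x; apply Rabs_sin_le. }
assert (Hcomb : forall (c1 c2 c3 c4 : R) (f1 f2 f3 f4 : R -> R),
  is_lim f1 p_infty 0 -> is_lim f2 p_infty 0 -> is_lim f3 p_infty 0 -> is_lim f4 p_infty 0 ->
  is_lim (fun x => c1 * f1 x + c2 * f2 x + (c3 * f3 x + c4 * f4 x)) p_infty 0).
{ intros c1 c2 c3 c4 f1 f2 f3 f4 H1 H2 H3 H4.
  replace 0 with ((c1 * 0 + c2 * 0) + (c3 * 0 + c4 * 0)) by ring.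
  apply (is_lim_plus' (fun x => c1 * f1 x + c2 * f2 x) (fun x => c3 * f3 x + c4 * f4 x));
  [apply (is_lim_plus' (fun x => c1 * f1 x) (fun x => c2 * f2 x))
  |apply (is_lim_plus' (fun x => c3 * f3 x) (fun x => c4 * f4 x))];
  match goal with |- is_lim (fun x => ?c * ?g x) _ _ => apply (is_lim_scal_l g c p_infty 0) end; assumption. }
(* [c + i d = 1 / (p + i q)]. Integration by parts reads [G_(a+1) = - (c + i d) x^(a+1) exp (- (p +
   i q) x) + (a + 1) (c + i d) G_a] for [G = U + i V]. *)
set (c := p / (p ^ 2 + q ^ 2)). set (d := - q / (p ^ 2 + q ^ 2)).
induction a as [|a [U [V [HU [HV [U0 [V0 [LU LV]]]]]]]].
(* The summands with coefficient 0 pad the base case to the four-term shape of [Hcomb]. *)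
- exists (fun x => - c * (x ^ 0 * exp (- (p * x)) * cos (q * x)) + - d * (x ^ 0 * exp (- (p * x)) * sin (q * x))
     + (0 * (x ^ 0 * exp (- (p * x)) * cos (q * x)) + 0 * (x ^ 0 * exp (- (p * x)) * cos (q * x)))).
  exists (fun x => - d * (x ^ 0 * exp (- (p * x)) * cos (q * x)) + c * (x ^ 0 * exp (- (p * x)) * sin (q * x))
     + (0 * (x ^ 0 * exp (- (p * x)) * cos (q * x)) + 0 * (x ^ 0 * exp (- (p * x)) * cos (q * x)))).
  split; [|split; [|split; [|split; [|split]]]].
  + intros x. auto_derive; auto. unfold c, d. simpl. field; nra.
  + intros x. auto_derive; auto. unfold c, d. simpl. field; nra.
  + rewrite ipow_S_Re by auto. unfold ipow, c, d. simpl.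
    rewrite !Rmult_0_r, Ropp_0, exp_0, cos_0, sin_0. field; nra.
  + rewrite ipow_S_Im by auto. unfold ipow, c, d. simpl.
    rewrite !Rmult_0_r, Ropp_0, exp_0, cos_0, sin_0. field; nra.
  + apply Hcomb; auto.
  + apply Hcomb; auto.
- exists (fun x => - c * (x ^ S a * exp (- (p * x)) * cos (q * x)) + - d * (x ^ S a * exp (- (p * x)) * sin (q * x))
     + (c * INR (S a) * U x + (- d * INR (S a)) * V x)).
  exists (fun x => - d * (x ^ S a * exp (- (p * x)) * cos (q * x)) + c * (x ^ S a * exp (- (p * x)) * sin (q * x))
     + (d * INR (S a) * U x + c * INR (S a) * V x)).
  assert (DU : forall x, Derive (fun x0 : R => U x0) x = x ^ a * exp (- (p * x)) * cos (q * x)).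
  { intros x. now apply is_derive_unique. }
  assert (DV : forall x, Derive (fun x0 : R => V x0) x = - (x ^ a * exp (- (p * x)) * sin (q * x))).
  { intros x. now apply is_derive_unique. }
  split; [|split; [|split; [|split; [|split]]]].
  + intros x. remember (INR (S a)) as b eqn:Hb. auto_derive.
    * split; [eexists; apply HU|split; [eexists; apply HV|auto]].
    * rewrite DU, DV. change (match a with 0%nat => 1 | S _ => INR a + 1 end) with (INR (S a)).
      rewrite <- Hb. unfold c, d. cbn [Nat.pred pow]. field; nra.
  + intros x. remember (INR (S a)) as b eqn:Hb. auto_derive.
    * split; [eexists; apply HU|split; [eexists; apply HV|auto]].
    * rewrite DU, DV. change (match a with 0%nat => 1 | S _ => INR a + 1 end) with (INR (S a)).
      rewrite <- Hb. unfold c, d. cbn [Nat.pred pow]. field; nra.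
  + rewrite U0, V0, (ipow_S_Re _ _ (S a)) by auto. rewrite fact_simpl, mult_INR, pow_i by lia.
    unfold c, d. field; nra.
  + rewrite U0, V0, (ipow_S_Im _ _ (S a)) by auto. rewrite fact_simpl, mult_INR, pow_i by lia.
    unfold c, d. field; nra.
  + apply Hcomb; auto.
  + apply Hcomb; auto.
Qed.

Lemma is_RInt_gen_pow_exp_cos (a : nat) (p q : R) : 0 < p ->
  is_RInt_gen (fun x => x ^ a * exp (- (p * x)) * cos (q * x)) (at_right 0) (Rbar_locally p_infty)
    (INR (fact a) * Re (ipow p q (S a))).
Proof.
intros Hp. destruct (laplace_antiderivative a p q Hp) as [U [V [HU [_ [U0 [_ [LU _]]]]]]].
replace (INR (fact a) * Re (ipow p q (S a))) with (0 - U 0) by (rewrite U0; ring).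
apply is_RInt_gen_antiderivative; auto.
intros x. apply (ex_derive_continuous (fun x => x ^ a * exp (- (p * x)) * cos (q * x))).
auto_derive. auto.
Qed.

Lemma is_RInt_gen_sum_n (f : nat -> R -> R) (l : nat -> R) (N : nat) :
  (forall n, is_RInt_gen (f n) (at_right 0) (Rbar_locally p_infty) (l n)) ->
  is_RInt_gen (fun x => sum_n (fun n => f n x) N) (at_right 0) (Rbar_locally p_infty) (sum_n l N).
Proof.
intros H. induction N as [|N IH].
- rewrite sum_O. apply (is_RInt_gen_ext (V := R_NormedModule) (f 0%nat)); auto.
  apply filter_forall. intros ab x Hx. now rewrite sum_O.
- rewrite sum_Sn.
  apply (is_RInt_gen_ext (V := R_NormedModule) (fun x => plus (sum_n (fun n => f n x) N) (f (S N) x))).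
  + apply filter_forall. intros ab x Hx. now rewrite sum_Sn.
  + apply (is_RInt_gen_plus (V := R_NormedModule)); auto.
Qed.

(** * Expansion of the kernel *)

(* [exp (- (1 - i) x)] *)
Definition zexp (x : R) : C := (exp (- x) * cos x, exp (- x) * sin x).

Lemma zexp_pow (x : R) (n : nat) :
  (zexp x ^ n)%C = (exp (- (INR n * x)) * cos (INR n * x), exp (- (INR n * x)) * sin (INR n * x)).
Proof.
induction n as [|n IH].
- simpl. rewrite Rmult_0_l, Ropp_0, exp_0, cos_0, sin_0. unfold RtoC. f_equal; ring.
- rewrite Cpow_S, IH, S_INR.
  replace ((INR n + 1) * x) with (x + INR n * x) by ring.
  rewrite cos_plus, sin_plus, Ropp_plus_distr, exp_plus.
  unfold zexp, Cmult. simpl. f_equal; ring.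
Qed.

Lemma Cmod_zexp (x : R) : Cmod (zexp x) = exp (- x).
Proof.
unfold Cmod, zexp. simpl fst; simpl snd.
replace ((exp (- x) * cos x) ^ 2 + (exp (- x) * sin x) ^ 2)
  with (Rsqr (exp (- x)) * (Rsqr (sin x) + Rsqr (cos x))) by (unfold Rsqr; ring).
rewrite sin2_cos2, Rmult_1_r. apply sqrt_Rsqr, Rlt_le, exp_pos.
Qed.

Lemma Cmod_1_minus_zexp (x : R) : 1 - exp (- x) <= Cmod (1 - zexp x).
Proof.
assert (H := Cmod_triangle (1 - zexp x) (zexp x)).
replace (1 - zexp x + zexp x)%C with (RtoC 1) in H by ring.
rewrite Cmod_1, Cmod_zexp in H. lra.
Qed.

Lemma exp_neg_div_le (x : R) : 0 < x -> exp (- x) / (1 - exp (- x)) <= / x.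
Proof.
intros Hx. assert (H1 := exp_neg_lt_1 x Hx). assert (He := exp_pos (- x)).
assert (Hexp := exp_ineq1 x ltac:(lra)).
assert (E : exp x * exp (- x) = 1) by (rewrite <- exp_plus, Rplus_opp_r; apply exp_0).
apply Rmult_le_reg_r with (x * (1 - exp (- x))); [nra|].
replace (exp (- x) / (1 - exp (- x)) * (x * (1 - exp (- x)))) with (exp (- x) * x) by (field; lra).
replace (/ x * (x * (1 - exp (- x)))) with (1 - exp (- x)) by (field; lra).
nra.
Qed.

Lemma sinh_ge (y : R) : 0 <= y -> y <= sinh y.
Proof.
intros Hy. destruct (MVT_gen sinh 0 y cosh) as [c [Hc Ec]].
- intros x _. apply is_derive_Reals, derivable_pt_lim_sinh.
- intros x _. apply derivable_continuous_pt, derivable_pt_sinh.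
- rewrite sinh_0 in Ec. assert (H := cosh_ge_1 c). nra.
Qed.

(** The left side is [1 / (2 sinh (x / 2))^2]. *)
Lemma exp_neg_div_sqr_le (x : R) : 0 < x -> exp (- x) / (1 - exp (- x)) ^ 2 <= / x ^ 2.
Proof.
intros Hx. replace x with (2 * (x / 2)) at 1 2 by field.
rewrite exp_neg_2_sinh. assert (Hs := sinh_ge (x / 2) ltac:(lra)).
assert (He := exp_pos (- (x / 2))).
replace (- (2 * (x / 2))) with (- (x / 2) + - (x / 2)) by field. rewrite exp_plus.
replace (exp (- (x / 2)) * exp (- (x / 2)) / (2 * sinh (x / 2) * exp (- (x / 2))) ^ 2)
  with (/ (2 * sinh (x / 2)) ^ 2) by (field; lra).
apply Rinv_le_contravar; [apply pow_lt; lra|]. apply pow_incr. lra.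
Qed.

(* Real and imaginary parts of [sum_{k <= N} (k + 1) zexp(x)^(k + 1)]. *)
Definition cos_sum (N : nat) (x : R) : R :=
  sum_n (fun k => INR (S k) * (exp (- (INR (S k) * x)) * cos (INR (S k) * x))) N.
Definition sin_sum (N : nat) (x : R) : R :=
  sum_n (fun k => INR (S k) * (exp (- (INR (S k) * x)) * sin (INR (S k) * x))) N.

Lemma one_minus_zexp_neq_0 (x : R) : 0 < x -> (1 - zexp x)%C <> 0.
Proof.
intros Hx. apply Cmod_gt_0. assert (H := Cmod_1_minus_zexp x). assert (H1 := exp_neg_lt_1 x Hx).
lra.
Qed.

(* The sum [sum_k k z^k = z / (1 - z)^2] with its explicit remainder after N + 1 terms. *)
Lemma zexp_partial_sum (N : nat) (x : R) : 0 < x ->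
  ((cos_sum N x, sin_sum N x) : C) =
  (zexp x / ((1 - zexp x) * (1 - zexp x)) -
   zexp x ^ S (S N) * (RtoC (INR (S (S N))) / (1 - zexp x) + zexp x / ((1 - zexp x) * (1 - zexp x))))%C.
Proof.
intros Hx. assert (H0 := one_minus_zexp_neq_0 x Hx).
induction N as [|N IH].
- transitivity (zexp x ^ 1)%C.
  + unfold cos_sum, sin_sum. rewrite !sum_O, zexp_pow. simpl INR. f_equal; ring.
  + rewrite Cpow_1_r. simpl INR. rewrite RtoC_plus. simpl Cpow. field. exact H0.
- transitivity ((cos_sum N x, sin_sum N x) + RtoC (INR (S (S N))) * zexp x ^ (S (S N)))%C.
  + rewrite zexp_pow. unfold cos_sum, sin_sum. rewrite !sum_Sn.
    unfold Cplus, Cmult, RtoC, plus; simpl fst; simpl snd. apply injective_projections; simpl; ring.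
  + rewrite IH. rewrite (S_INR (S (S N))), RtoC_plus. rewrite (Cpow_S _ (S (S N))).
    field. exact H0.
Qed.

(** Of the [N + 2] factors [exp (- x)] in [|z|^(N + 2)], one is spent on
    [exp (- x) / |1 - z| <= 1 / x]. This leaves an exponential times powers of [x], whose integral
    against [x^a] is explicit. *)
Lemma zexp_tail_le (N : nat) (x : R) : 0 < x ->
  Cmod (zexp x ^ S (S N) * (RtoC (INR (S (S N))) / (1 - zexp x) + zexp x / ((1 - zexp x) * (1 - zexp x)))) <=
  exp (- (INR (S N) * x)) * ((INR (S N) + 1) / x + / x ^ 2).
Proof.
intros Hx. assert (H0 := one_minus_zexp_neq_0 x Hx).
assert (H1 := Cmod_1_minus_zexp x). assert (H2 := exp_neg_lt_1 x Hx).
assert (H3 := exp_neg_div_le x Hx). assert (He := exp_pos (- x)).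
assert (HN := INR_S_ge_1 N).
set (r := exp (- x)) in *. set (z := zexp x) in *.
assert (Hr1 : / Cmod (1 - z) <= / (1 - r)) by (apply Rinv_le_contravar; lra).
assert (Hr0 : 0 < / Cmod (1 - z)) by (apply Rinv_0_lt_compat; lra).
assert (Hinv : 0 <= / x) by (apply Rlt_le, Rinv_0_lt_compat; lra).
assert (Hg : r * / Cmod (1 - z) <= / x).
{ apply Rle_trans with (2 := H3). apply Rmult_le_compat_l; lra. }
assert (Hg0 : 0 <= r * / Cmod (1 - z)) by nra.
rewrite Cmod_mult.
apply Rle_trans with (Cmod (z ^ S (S N)) *
  (INR (S (S N)) * / Cmod (1 - z) + r * / Cmod (1 - z) * / Cmod (1 - z))).
{ apply Rmult_le_compat_l; [apply Cmod_ge_0|].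
  apply Rle_trans with (1 := Cmod_triangle _ _).
  unfold Cdiv. rewrite !Cmod_mult, Cmod_R, Rabs_pos_eq by apply pos_INR.
  rewrite !Cmod_inv, Cmod_mult.
  - unfold z at 2. rewrite Cmod_zexp. fold r. rewrite Rinv_mult. right; ring.
  - now apply Cmult_neq_0.
  - exact H0. }
rewrite Cpow_S, Cmod_mult, Cmod_pow. unfold z at 1 2. rewrite Cmod_zexp. fold r.
replace (exp (- (INR (S N) * x))) with (r ^ S N).
2:{ unfold r. rewrite <- Rpower_pow by apply exp_pos. unfold Rpower. rewrite ln_exp. f_equal. ring. }
assert (HrN := pow_lt r (S N) He).
replace (r * r ^ S N * (INR (S (S N)) * / Cmod (1 - z) + r * / Cmod (1 - z) * / Cmod (1 - z)))
  with (r ^ S N * (INR (S (S N)) * (r * / Cmod (1 - z)) + (r * / Cmod (1 - z)) * (r * / Cmod (1 - z)))) by ring.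
apply Rmult_le_compat_l; [lra|]. rewrite (S_INR (S N)).
apply Rplus_le_compat.
- apply Rmult_le_compat_l; lra.
- rewrite <- pow_inv. simpl (_ ^ 2). rewrite Rmult_1_r. apply Rmult_le_compat; auto.
Qed.

Lemma sum_n_C_le (a : nat -> R) (z : nat -> C) (N : nat) :
  (forall k, Cmod (z k) <= a k) ->
  Cmod (sum_n (fun k => Re (z k)) N, sum_n (fun k => Im (z k)) N) <= sum_n a N.
Proof.
intros H. induction N as [|N IH].
- rewrite !sum_O. specialize (H 0%nat). destruct (z 0%nat). exact H.
- rewrite !sum_Sn.
  apply Rle_trans with (Cmod ((sum_n (fun k => Re (z k)) N, sum_n (fun k => Im (z k)) N) + z (S N))).
  + right. f_equal.
  + apply Rle_trans with (1 := Cmod_triangle _ _). now apply Rplus_le_compat.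
Qed.

(** Termwise moduli sum to [exp (- x) / (1 - exp (- x)) ^ 2], so partial sums obey, uniformly in
    [N], the bound of the full sum. *)
Lemma Cmod_partial_sum_le (N : nat) (x : R) : 0 < x ->
  Cmod (cos_sum N x, sin_sum N x) <= / x ^ 2.
Proof.
intros Hx. apply Rle_trans with (2 := exp_neg_div_sqr_le x Hx).
rewrite <- Series_pow_exp_1 by auto.
apply Rle_trans with (sum_n (fun n => INR (S n) * exp (- (x * INR (S n)))) N).
- apply (sum_n_C_le (fun n => INR (S n) * exp (- (x * INR (S n))))
    (fun k => (INR (S k) * (exp (- (INR (S k) * x)) * cos (INR (S k) * x)),
               INR (S k) * (exp (- (INR (S k) * x)) * sin (INR (S k) * x))))).
  intros k.
  replace (INR (S k) * (exp (- (INR (S k) * x)) * cos (INR (S k) * x)),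
               INR (S k) * (exp (- (INR (S k) * x)) * sin (INR (S k) * x)))
    with (RtoC (INR (S k)) * (zexp x ^ S k))%C.
  + rewrite Cmod_mult, Cmod_R, Rabs_pos_eq by apply pos_INR.
    rewrite Cmod_pow, Cmod_zexp. right. f_equal.
    rewrite <- Rpower_pow by apply exp_pos. unfold Rpower. rewrite ln_exp. f_equal. ring.
  + rewrite zexp_pow. generalize (INR (S k)). intros b. apply injective_projections; simpl; ring.
- apply sum_n_le_Series.
  + intros n. apply Rmult_le_pos; [apply pos_INR|apply Rlt_le, exp_pos].
  + apply ex_series_ext with (2 := ex_series_pow_exp x 1 Hx). intros n. now rewrite pow_1.
Qed.

Lemma cosh_minus_cos_pos (x : R) : 0 < x -> 0 < cosh x - cos x.
Proof.
intros Hx. assert (Hs := sinh_pos x Hx). assert (Hc := cosh_sqr x). assert (H1 := cosh_ge_1 x).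
assert (Hcos := COS_bound x). nra.
Qed.

(** It rests on [|1 - z|^2 = 2 exp (- x) (cosh x - cos x)], where the exponential cancels against
    [|z|]. *)
Lemma Cmod_zexp_sum_sqr (x : R) : 0 < x ->
  Cmod (zexp x / ((1 - zexp x) * (1 - zexp x))) ^ 2 = / (4 * (cos x - cosh x) ^ 2).
Proof.
intros Hx. assert (H0 := one_minus_zexp_neq_0 x Hx).
assert (HD : Cmod (1 - zexp x) ^ 2 = 2 * exp (- x) * (cosh x - cos x)).
{ unfold Cmod. rewrite pow2_sqrt by (apply Rplus_le_le_0_compat; apply pow2_ge_0).
  unfold zexp; simpl fst; simpl snd. unfold cosh.
  assert (E : exp x * exp (- x) = 1) by (rewrite <- exp_plus, Rplus_opp_r; apply exp_0).
  assert (E2 := sin2_cos2 x). unfold Rsqr in E2.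
  transitivity (1 - 2 * exp (- x) * cos x + exp (- x) ^ 2 * (sin x * sin x + cos x * cos x)); [ring|].
  rewrite E2. transitivity (exp x * exp (- x) + exp (- x) * exp (- x) - 2 * exp (- x) * cos x); [rewrite E; ring|field]. }
unfold Cdiv. rewrite Cmod_mult, Cmod_inv by now apply Cmult_neq_0.
rewrite Cmod_mult, Cmod_zexp.
replace ((exp (- x) * / (Cmod (1 - zexp x) * Cmod (1 - zexp x))) ^ 2)
  with (exp (- x) ^ 2 / (Cmod (1 - zexp x) ^ 2) ^ 2).
- rewrite HD. assert (Hp := cosh_minus_cos_pos x Hx). assert (He := exp_pos (- x)). field. lra.
- apply Cmod_gt_0 in H0. field. lra.
Qed.

(* With [T = z / (1 - z)^2] the kernel is [4 |T|^2], which is compared with [4 |T_N|^2]. *)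
Lemma kernel_approximation (N : nat) (x : R) : 0 < x ->
  Rabs (/ (cos x - cosh x) ^ 2 - 4 * (cos_sum N x ^ 2 + sin_sum N x ^ 2)) <=
  8 * / x ^ 2 * (exp (- (INR (S N) * x)) * ((INR (S N) + 1) / x + / x ^ 2)).
Proof.
intros Hx. assert (H1 := Cmod_zexp_sum_sqr x Hx).
assert (H2 := zexp_tail_le N x Hx). assert (H3 := zexp_partial_sum N x Hx).
assert (H4 := Cmod_partial_sum_le N x Hx).
set (T := (zexp x / ((1 - zexp x) * (1 - zexp x)))%C) in *.
set (W := ((cos_sum N x, sin_sum N x) : C)) in *.
assert (H5 : Cmod T <= / x ^ 2).
{ apply Rle_trans with (2 := exp_neg_div_sqr_le x Hx).
  assert (H0 := one_minus_zexp_neq_0 x Hx). assert (HC := Cmod_1_minus_zexp x).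
  assert (HE := exp_neg_lt_1 x Hx).
  unfold T, Cdiv. rewrite Cmod_mult, Cmod_inv by now apply Cmult_neq_0.
  rewrite Cmod_mult, Cmod_zexp. apply Rmult_le_compat_l; [apply Rlt_le, exp_pos|].
  apply Rinv_le_contravar; [apply pow_lt; lra|]. simpl. rewrite Rmult_1_r.
  apply Rmult_le_compat; lra. }
assert (HW : cos_sum N x ^ 2 + sin_sum N x ^ 2 = Cmod W ^ 2).
{ unfold Cmod. rewrite pow2_sqrt; [reflexivity|].
  apply Rplus_le_le_0_compat; apply pow2_ge_0. }
set (q := exp (- (INR (S N) * x)) * ((INR (S N) + 1) / x + / x ^ 2)) in *.
assert (HTW : Rabs (Cmod T - Cmod W) <= q).
{ apply Rle_trans with (2 := H2). rewrite H3.
  set (t := (zexp x ^ S (S N) * _)%C).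
  assert (A1 := Cmod_triangle (T - t) t). replace (T - t + t)%C with T in A1 by ring.
  assert (A2 := Cmod_triangle T (- t)). rewrite Cmod_opp in A2.
  change (T + - t)%C with (T - t)%C in A2. apply Rabs_le. lra. }
rewrite HW.
replace (/ (cos x - cosh x) ^ 2) with (4 * Cmod T ^ 2).
2:{ rewrite H1. assert (Hp := cosh_minus_cos_pos x Hx). field. lra. }
replace (4 * Cmod T ^ 2 - 4 * Cmod W ^ 2) with (4 * ((Cmod T + Cmod W) * (Cmod T - Cmod W))) by ring.
assert (P1 := Cmod_ge_0 T). assert (P2 := Cmod_ge_0 W).
rewrite Rabs_mult, (Rabs_pos_eq 4), Rabs_mult, (Rabs_pos_eq (Cmod T + Cmod W)) by lra.
replace (8 * / x ^ 2 * q) with (4 * ((/ x ^ 2 + / x ^ 2) * q)) by ring.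
apply Rmult_le_compat_l; [lra|]. apply Rmult_le_compat; try lra. apply Rabs_pos.
Qed.

(** * Finite lattice sums and the integral of the truncated kernel *)

Definition lattice_sum (N : nat) (u : nat -> nat -> R) : R :=
  sum_n (fun m => sum_n (fun k => INR (S m) * INR (S k) * u m k) N) N.

Lemma lattice_sum_ext (N : nat) (u v : nat -> nat -> R) :
  (forall m k, u m k = v m k) -> lattice_sum N u = lattice_sum N v.
Proof.
intros H. apply sum_n_ext. intros m. apply sum_n_ext. intros k. now rewrite H.
Qed.

Lemma lattice_sum_linear (N : nat) (c d : R) (u v : nat -> nat -> R) :
  lattice_sum N (fun m k => c * u m k + d * v m k) = c * lattice_sum N u + d * lattice_sum N v.
Proof.
unfold lattice_sum.
rewrite <- !(sum_n_mult_l (K := R_AbsRing)), <- (sum_n_plus (G := R_AbelianMonoid)).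
apply sum_n_ext. intros m.
rewrite <- !(sum_n_mult_l (K := R_AbsRing)), <- (sum_n_plus (G := R_AbelianMonoid)).
apply sum_n_ext. intros k. unfold mult, plus; simpl. real_eq. ring.
Qed.

Lemma lattice_sum_swap (N : nat) (u : nat -> nat -> R) :
  lattice_sum N u = lattice_sum N (fun m k => u k m).
Proof.
unfold lattice_sum. rewrite (sum_n_switch (G := R_AbelianMonoid)).
apply sum_n_ext. intros m. apply sum_n_ext. intros k.
now rewrite (Rmult_comm (INR (S k))).
Qed.

Lemma sum_n_sqr (f : nat -> R) (N : nat) :
  sum_n f N ^ 2 = sum_n (fun m => sum_n (fun k => f m * f k) N) N.
Proof.
transitivity (sum_n (fun m => mult (f m) (sum_n f N)) N).
- rewrite (sum_n_mult_r (K := R_AbsRing)). simpl. now rewrite Rmult_1_r.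
- apply sum_n_ext. intros m. symmetry. apply (sum_n_mult_l (K := R_AbsRing) (f m) f N).
Qed.

Lemma partial_sum_sqr (N : nat) (x : R) :
  cos_sum N x ^ 2 + sin_sum N x ^ 2 =
  lattice_sum N (fun m k => exp (- ((INR (S m) + INR (S k)) * x)) * cos ((INR (S k) - INR (S m)) * x)).
Proof.
unfold cos_sum, sin_sum, lattice_sum. rewrite !sum_n_sqr, <- (sum_n_plus (G := R_AbelianMonoid)).
apply sum_n_ext. intros m. rewrite <- (sum_n_plus (G := R_AbelianMonoid)).
apply sum_n_ext. intros k. unfold plus; simpl plus.
rewrite !Rmult_minus_distr_r, cos_minus, Rmult_plus_distr_r, Ropp_plus_distr, exp_plus.
simpl. real_eq. ring.
Qed.

Lemma is_RInt_gen_lattice (a N : nat) :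
  is_RInt_gen (fun x => 4 * x ^ a * (cos_sum N x ^ 2 + sin_sum N x ^ 2))
    (at_right 0) (Rbar_locally p_infty)
    (4 * INR (fact a) * lattice_sum N (fun m k =>
      Re (ipow (INR (S m) + INR (S k)) (INR (S k) - INR (S m)) (S a)))).
Proof.
assert (H : is_RInt_gen (fun x => sum_n (fun m => sum_n (fun k =>
    scal (4 * INR (S m) * INR (S k))
    (x ^ a * exp (- ((INR (S m) + INR (S k)) * x)) * cos ((INR (S k) - INR (S m)) * x))) N) N)
   (at_right 0) (Rbar_locally p_infty)
   (sum_n (fun m => sum_n (fun k => scal (4 * INR (S m) * INR (S k)) (INR (fact a) *
     Re (ipow (INR (S m) + INR (S k)) (INR (S k) - INR (S m)) (S a)))) N) N)).
{ apply is_RInt_gen_sum_n. intros m. apply is_RInt_gen_sum_n. intros k.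
  apply (is_RInt_gen_scal (V := R_NormedModule)), is_RInt_gen_pow_exp_cos.
  generalize (INR_S_pos m) (INR_S_pos k). lra. }
assert (Hl : forall c u, sum_n (fun m => sum_n (fun k => scal (4 * INR (S m) * INR (S k)) (c * u m k)) N) N
  = 4 * c * lattice_sum N u).
{ intros c u. rewrite <- (Rplus_0_r (4 * c * lattice_sum N u)), <- (Rmult_0_l (lattice_sum N u)).
  rewrite <- lattice_sum_linear. apply sum_n_ext. intros m. apply sum_n_ext. intros k.
  unfold scal; simpl. unfold mult; simpl. real_eq. ring. }
rewrite Hl in H.
apply (is_RInt_gen_ext (V := R_NormedModule)) with (2 := H).
apply filter_forall. intros ab x Hx.
rewrite partial_sum_sqr, <- Hl.
apply sum_n_ext. intros m. apply sum_n_ext. intros k. f_equal. real_eq. ring.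
Qed.

(** * Comparison of the two lattice sums *)

Lemma is_lim_seq_inv_INR : is_lim_seq (fun n => / INR (S n)) 0.
Proof.
apply (is_lim_seq_incr_1 (fun n => / INR n)).
replace (Finite 0) with (Rbar_inv p_infty) by reflexivity.
apply is_lim_seq_inv; [apply is_lim_seq_INR|discriminate].
Qed.

Lemma Rabs_Re_ipow_0_le (t : R) (n p : nat) : 1 <= t -> (p <= n)%nat ->
  Rabs (Re (ipow t 0 n)) <= / t ^ p.
Proof.
intros Ht Hn. apply Rle_trans with (1 := Re_le_Cmod _). rewrite Cmod_ipow by lra.
change (t, 0) with (RtoC t). rewrite Cmod_R, Rabs_pos_eq by lra.
apply Rinv_le_contravar; [apply pow_lt; lra|]. now apply Rle_pow.
Qed.

(** With [a = 4 + b], multiplying the kernel error by [x^a] gives [8 ((N + 2) x^(b+1) + x^b) exp (-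
    (N + 1) x)]. Its integral is of order [1 / N] already for [b = 0]. *)
Lemma berndt_integral_limit (b : nat) : exists L,
  is_RInt_gen (fun x => x ^ (4 + b) / (cos x - cosh x) ^ 2) (at_right 0) (Rbar_locally p_infty) L /\
  is_lim_seq (fun N => 4 * INR (fact (4 + b)) * lattice_sum N (fun m k =>
      Re (ipow (INR (S m) + INR (S k)) (INR (S k) - INR (S m)) (S (4 + b))))) L.
Proof.
apply is_RInt_gen_of_approximations with
  (h := fun N x => 4 * x ^ (4 + b) * (cos_sum N x ^ 2 + sin_sum N x ^ 2))
  (* The factor [cos (0 * x) = 1] puts the majorant in the form of [is_RInt_gen_pow_exp_cos] with
     [q = 0]. *)
  (e := fun N x => 8 * ((INR (S N) + 1) * (x ^ (S b) * exp (- (INR (S N) * x)) * cos (0 * x)) +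
     x ^ b * exp (- (INR (S N) * x)) * cos (0 * x)))
  (E := fun N => 8 * ((INR (S N) + 1) * (INR (fact (S b)) * Re (ipow (INR (S N)) 0 (S (S b)))) +
     INR (fact b) * Re (ipow (INR (S N)) 0 (S b)))).
- intros x Hx. apply (ex_derive_continuous (fun x => x ^ (4 + b) / (cos x - cosh x) ^ 2)).
  assert (Hp := cosh_minus_cos_pos x Hx). unfold cosh in *.
  auto_derive. repeat split; auto. rewrite Rmult_1_r. apply Rmult_integral_contrapositive_currified; lra.
- intros N x Hx. assert (H := kernel_approximation N x Hx).
  assert (Hxa := pow_lt x (4 + b) Hx).
  rewrite Rmult_0_l, cos_0, !Rmult_1_r.
  replace (x ^ (4 + b) / (cos x - cosh x) ^ 2 - 4 * x ^ (4 + b) * (cos_sum N x ^ 2 + sin_sum N x ^ 2))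
    with (x ^ (4 + b) * (/ (cos x - cosh x) ^ 2 - 4 * (cos_sum N x ^ 2 + sin_sum N x ^ 2)))
    by (unfold Rdiv; ring).
  rewrite Rabs_mult, (Rabs_pos_eq (x ^ (4 + b))) by lra.
  apply Rle_trans with (1 := Rmult_le_compat_l _ _ _ (Rlt_le _ _ Hxa) H).
  right. change (4 + b)%nat with (S (S (S (S b)))). cbn [pow]. field. lra.
- intros N. apply is_RInt_gen_lattice.
- intros N. apply (is_RInt_gen_scal (V := R_NormedModule)
    (fun x => (INR (S N) + 1) * (x ^ (S b) * exp (- (INR (S N) * x)) * cos (0 * x)) +
     x ^ b * exp (- (INR (S N) * x)) * cos (0 * x))).
  apply (is_RInt_gen_plus (V := R_NormedModule)).
  + apply (is_RInt_gen_scal (V := R_NormedModule)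
      (fun x => x ^ (S b) * exp (- (INR (S N) * x)) * cos (0 * x))).
    apply is_RInt_gen_pow_exp_cos, INR_S_pos.
  + apply is_RInt_gen_pow_exp_cos, INR_S_pos.
- apply is_lim_seq_abs_0.
  apply is_lim_seq_le_le with (fun _ => 0)
    (fun N => 8 * (2 * INR (fact (S b)) + INR (fact b)) * / INR (S N)).
  + intros N. split; [apply Rabs_pos|].
    assert (HN := INR_S_ge_1 N). set (t := INR (S N)) in *.
    assert (H1 := Rabs_Re_ipow_0_le t (S (S b)) 2 HN ltac:(lia)).
    assert (H2 := Rabs_Re_ipow_0_le t (S b) 1 HN ltac:(lia)). rewrite pow_1 in H2.
    assert (F1 := pos_INR (fact (S b))). assert (F2 := pos_INR (fact b)).
    rewrite Rabs_mult, (Rabs_pos_eq 8) by lra. rewrite Rmult_assoc.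
    apply Rmult_le_compat_l; [lra|].
    apply Rle_trans with (1 := Rabs_triang _ _).
    rewrite !Rabs_mult, (Rabs_pos_eq _ F1), (Rabs_pos_eq _ F2), (Rabs_pos_eq (t + 1)) by lra.
    rewrite (Rmult_plus_distr_r (2 * _)). apply Rplus_le_compat.
    * apply Rle_trans with ((t + t) * (INR (fact (S b)) * / t ^ 2)).
      -- apply Rmult_le_compat; try lra.
         ++ apply Rmult_le_pos; [auto|apply Rabs_pos].
         ++ apply Rmult_le_compat_l; auto.
      -- right. field. lra.
    * apply Rmult_le_compat_l; auto.
  + apply is_lim_seq_const.
  + rewrite <- (Rmult_0_r (8 * (2 * INR (fact (S b)) + INR (fact b)))).
    apply (is_lim_seq_scal_l _ _ 0), is_lim_seq_inv_INR.
Qed.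

(** The frequencies of the integral form a rotated lattice:
    [(m + k) + i (k - m) = (1 - i) (m + i k)]. *)
Lemma ipow_rotate (m k : R) (n : nat) : 0 < m -> 0 < k ->
  ipow (m + k) (k - m) n = ((/ (1 - Ci)) ^ n * ipow m k n)%C.
Proof.
intros Hm Hk. unfold ipow. rewrite <- Cpow_mult_l. f_equal.
assert (H1 : (1 - Ci)%C <> 0) by (intros H; injection H; lra).
assert (H2 := pair_neq_0 m k Hm).
replace ((m + k, k - m) : C) with ((1 - Ci) * (m, k))%C by (apply injective_projections; simpl; ring).
field. now split.
Qed.

Lemma ipow_conj (t k : R) (n : nat) : 0 < t -> ipow t (- k) n = Cconj (ipow t k n).
Proof.
intros Ht. unfold ipow. rewrite Cpow_conj. f_equal.
unfold Cinv, Cconj; simpl. f_equal; field; nra.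
Qed.

Lemma ipow_swap (m k : R) (n : nat) : 0 < m -> 0 < k ->
  ipow k m n = ((- Ci) ^ n * Cconj (ipow m k n))%C.
Proof.
intros Hm Hk. rewrite <- ipow_conj by auto. unfold ipow. rewrite <- Cpow_mult_l. f_equal.
apply injective_projections; simpl; field; nra.
Qed.

(** Exchanging [m] and [k] conjugates the rotated term, so the imaginary parts cancel over a square
    and the complex sum, from which [ipow_rotate] extracts the constant, is real. *)
Lemma lattice_sum_rotate (N n : nat) :
  RtoC (lattice_sum N (fun m k => Re (ipow (INR (S m) + INR (S k)) (INR (S k) - INR (S m)) n))) =
  ((/ (1 - Ci)) ^ n * (lattice_sum N (fun m k => Re (ipow (INR (S m)) (INR (S k)) n)),
                       lattice_sum N (fun m k => Im (ipow (INR (S m)) (INR (S k)) n))))%C.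
Proof.
assert (Him : lattice_sum N (fun m k => Im (ipow (INR (S m) + INR (S k)) (INR (S k) - INR (S m)) n)) = 0).
(* The sum equals its own negative; the zero summand brings this into the shape of
   [lattice_sum_linear]. *)
{ assert (H : forall x, x = 0 * 0 + -1 * x -> x = 0) by (intros x Hx; lra).
  apply H. rewrite lattice_sum_swap at 1.
  rewrite <- (Rmult_0_l (lattice_sum N (fun m k => 0))) at 1.
  transitivity (lattice_sum N (fun m k => 0 * 0 + -1 *
     Im (ipow (INR (S m) + INR (S k)) (INR (S k) - INR (S m)) n))).
  - apply lattice_sum_ext. intros m k.
    rewrite (Rplus_comm (INR (S k))).
    replace (INR (S m) - INR (S k)) with (- (INR (S k) - INR (S m))) by ring.
    rewrite ipow_conj by (generalize (INR_S_pos m) (INR_S_pos k); lra).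
    unfold Cconj, Im; simpl. ring.
  - rewrite (lattice_sum_linear N 0 (-1) (fun _ _ => 0)). ring. }
destruct ((/ (1 - Ci)) ^ n)%C as [c d] eqn:E.
assert (Hrot : forall m k, ipow (INR (S m) + INR (S k)) (INR (S k) - INR (S m)) n =
   ((c, d) * ipow (INR (S m)) (INR (S k)) n)%C).
{ intros m k. rewrite ipow_rotate, E by apply INR_S_pos. reflexivity. }
apply injective_projections.
- unfold RtoC, Cmult; cbn [fst snd]. transitivity (c * lattice_sum N (fun m k => Re (ipow (INR (S m)) (INR (S k)) n)) +
    - d * lattice_sum N (fun m k => Im (ipow (INR (S m)) (INR (S k)) n))); [|ring].
  rewrite <- lattice_sum_linear. apply lattice_sum_ext. intros m k. rewrite Hrot.
  generalize (ipow (INR (S m)) (INR (S k)) n). intros [u v]. unfold Re, Im; simpl. ring.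
- unfold RtoC, Cmult; cbn [fst snd]. rewrite <- Him. rewrite <- lattice_sum_linear. apply lattice_sum_ext. intros m k. rewrite Hrot.
  generalize (ipow (INR (S m)) (INR (S k)) n). intros [u v]. unfold Re, Im; simpl. ring.
Qed.

Lemma lattice_sum_conj (N n : nat) :
  let A := lattice_sum N (fun m k => Re (ipow (INR (S m)) (INR (S k)) n)) in
  let B := lattice_sum N (fun m k => Im (ipow (INR (S m)) (INR (S k)) n)) in
  ((A, B) = (- Ci) ^ n * (A, (- B)%R))%C.
Proof.
intros A B. destruct ((- Ci) ^ n)%C as [c d] eqn:E.
assert (Hsw : forall m k, ipow (INR (S k)) (INR (S m)) n =
   ((c, d) * Cconj (ipow (INR (S m)) (INR (S k)) n))%C).
{ intros m k. rewrite (ipow_swap (INR (S m))), E by apply INR_S_pos. reflexivity. }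
apply injective_projections; unfold Cmult; cbn [fst snd].
- transitivity (c * A + d * B); [|ring].
  unfold A at 1. rewrite lattice_sum_swap. unfold A, B. rewrite <- lattice_sum_linear.
  apply lattice_sum_ext. intros m k. rewrite Hsw.
  generalize (ipow (INR (S m)) (INR (S k)) n). intros [u v]. unfold Re, Im; simpl. ring.
- transitivity (d * A + - c * B); [|ring].
  unfold B at 1. rewrite lattice_sum_swap. unfold A, B. rewrite <- lattice_sum_linear.
  apply lattice_sum_ext. intros m k. rewrite Hsw.
  generalize (ipow (INR (S m)) (INR (S k)) n). intros [u v]. unfold Re, Im; simpl. ring.
Qed.

Lemma finite_lattice_identity (N p : nat) :
  ((RtoC 1 - Ci ^ S (S p)) / (RtoC PI ^ S p * (RtoC 1 + Ci) ^ p) *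
   RtoC (4 * INR (fact (S p)) * lattice_sum N (fun m k =>
      Re (ipow (INR (S m) + INR (S k)) (INR (S k) - INR (S m)) (S (S p))))))%C =
  RtoC (- 8 * INR (fact (S p)) / (2 * PI) ^ S p *
    lattice_sum N (fun m k => Im (ipow (INR (S m)) (INR (S k)) (S (S p))))).
Proof.
assert (HP := PI_RGT_0).
assert (HC := lattice_sum_conj N (S (S p))). cbv zeta in HC.
rewrite RtoC_mult, lattice_sum_rotate.
set (A := lattice_sum N (fun m k => Re (ipow (INR (S m)) (INR (S k)) (S (S p))))) in *.
set (B := lattice_sum N (fun m k => Im (ipow (INR (S m)) (INR (S k)) (S (S p))))) in *.
assert (HI : (Ci ^ S (S p) * (A, B) = (A, (- B)%R))%C).
{ rewrite HC, Cmult_assoc, <- Cpow_mult_l.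
  replace (Ci * - Ci)%C with (RtoC 1) by (apply injective_projections; simpl; ring).
  rewrite Cpow_1_l. apply Cmult_1_l. }
(* [A + i B] minus its conjugate: only the imaginary part survives. *)
assert (HB : ((1 - Ci ^ S (S p)) * (A, B) = 2 * Ci * B)%C).
{ transitivity ((A, B) - Ci ^ S (S p) * (A, B))%C; [ring|]. rewrite HI.
  apply injective_projections; simpl; ring. }
assert (Q0 : (1 - Ci)%C <> 0) by (intros H; injection H; lra).
assert (P0 : (1 + Ci)%C <> 0) by (intros H; injection H; lra).
(* Pairing [p] factors by [(1 + i) (1 - i) = 2] leaves [(1 - i)^2 = - 2 i], whose [i] cancels the
   one in [HB]. *)
assert (PQ : ((1 + Ci) ^ p * (1 - Ci) ^ S (S p) = 2 ^ p * (- 2 * Ci))%C).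
{ rewrite !Cpow_S, !Cmult_assoc, (Cmult_comm _ (1 - Ci)), Cmult_assoc.
  transitivity ((1 - Ci) * (1 - Ci) * ((1 + Ci) ^ p * (1 - Ci) ^ p))%C; [ring|].
  rewrite <- Cpow_mult_l.
  replace ((1 + Ci) * (1 - Ci))%C with (RtoC 2) by (apply injective_projections; simpl; ring).
  replace ((1 - Ci) * (1 - Ci))%C with (- 2 * Ci)%C by (apply injective_projections; simpl; ring).
  ring. }
assert (Hpi : (RtoC PI ^ S p)%C <> 0).
{ apply Cpow_nz. intros H; injection H; lra. }
assert (H2 : (RtoC 2 ^ p)%C <> 0).
{ apply Cpow_nz. intros H; injection H; lra. }
assert (Ci0 : Ci <> 0) by (intros H; injection H; lra).
assert (HPp := Cpow_nz _ p P0). assert (HQp := Cpow_nz _ (S (S p)) Q0).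
rewrite Cpow_inv by exact Q0.
transitivity ((1 - Ci ^ S (S p)) * (A, B) * RtoC (4 * INR (fact (S p))) /
   (RtoC PI ^ S p * ((1 + Ci) ^ p * (1 - Ci) ^ S (S p))))%C.
{ field. repeat split; assumption. }
rewrite HB, PQ.
replace (- 8 * INR (fact (S p)) / (2 * PI) ^ S p * B)
  with (- (2 * B * (4 * INR (fact (S p)))) / (PI ^ S p * (2 ^ p * 2))).
2:{ rewrite Rpow_mult_distr. simpl (2 ^ S p). field. split; apply pow_nonzero; lra. }
assert (P1 := pow_nonzero PI (S p) ltac:(lra)). assert (P2 := pow_nonzero 2 p ltac:(lra)).
rewrite RtoC_div by (apply Rmult_integral_contrapositive_currified; lra).
rewrite RtoC_opp, !RtoC_mult, !RtoC_pow.
field. split; [exact H2|split; [exact Hpi|exact Ci0]].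
Qed.

Theorem theorem4p3 : forall a : nat, (4 <= a)%nat ->
  ex_RInt_gen (fun x : R => x ^ a / (cos x - cosh x) ^ 2)
    (at_right 0) (Rbar_locally p_infty) /\
  ex_series (fun k : nat => INR (S k) ^ (a - 1) / sinh (INR (S k) * PI) ^ 2) /\
  ex_series (fun k : nat =>
    INR (S k) ^ a * cosh (INR (S k) * PI) / sinh (INR (S k) * PI) ^ 3) /\
  ((RtoC 1 - Ci ^ (a + 1)) / (RtoC PI ^ a * (RtoC 1 + Ci) ^ (a - 1)) *
     RtoC (RInt_gen (fun x : R => (x ^ a / (cos x - cosh x) ^ 2)%R)
             (at_right 0) (Rbar_locally p_infty)))%C =
  RtoC (INR a * Series (fun k : nat =>
                  INR (S k) ^ (a - 1) / sinh (INR (S k) * PI) ^ 2)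
        - 2 * PI * Series (fun k : nat =>
                  INR (S k) ^ a * cosh (INR (S k) * PI) /
                  sinh (INR (S k) * PI) ^ 3)).
Proof.
intros a Ha. destruct (berndt_integral_limit (a - 4)) as [L [HL Hlim]].
replace (4 + (a - 4))%nat with a in HL, Hlim by lia.
split; [now exists L|split; [apply ex_series_csch2|split; [apply ex_series_cosh_csch3|]]].
rewrite (is_RInt_gen_unique _ _ HL). clear HL.
destruct a as [|[|j]]; [lia|lia|].
rewrite Nat.add_1_r. replace (S (S j) - 1)%nat with (S j) by lia.
rewrite hyperbolic_series_lattice.
assert (HR := is_lim_seq_lattice (S (S (S j))) ltac:(lia)).
apply (is_lim_seq_scal_l _ (- 8 * INR (fact (S (S j))) / (2 * PI) ^ S (S j))) in HR.
assert (HF := fun N => finite_lattice_identity N (S j)).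
(* With the prefactor written [c + i d], the finite identity says for every [N] that [c] times the
   approximating integral is the lattice sum and [d] times it is 0; two real limits then give the
   two components. *)
destruct ((RtoC 1 - Ci ^ S (S (S j))) / (RtoC PI ^ S (S j) * (RtoC 1 + Ci) ^ S j))%C as [c d].
assert (Hc := is_lim_seq_scal_l _ c _ Hlim). assert (Hd := is_lim_seq_scal_l _ d _ Hlim).
apply injective_projections; simpl.
- rewrite Rmult_0_r, Rminus_0_r.
  apply (is_lim_seq_ext _ (fun N => - 8 * INR (fact (S (S j))) / (2 * PI) ^ S (S j) *
     lattice_sum N (fun m k => Im (ipow (INR (S m)) (INR (S k)) (S (S (S j))))))) in Hc.
  + apply is_lim_seq_unique in Hc. apply is_lim_seq_unique in HR.
    assert (H := eq_trans (eq_sym Hc) HR). now injection H.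
  + intros N. specialize (HF N). apply (f_equal fst) in HF. simpl in HF.
    rewrite Rmult_0_r, Rminus_0_r in HF. exact HF.
- rewrite Rmult_0_r, Rplus_0_l.
  apply (is_lim_seq_ext _ (fun N => 0)) in Hd.
  + apply is_lim_seq_unique in Hd. rewrite Lim_seq_const in Hd. now injection Hd.
  + intros N. specialize (HF N). apply (f_equal snd) in HF. simpl in HF.
    rewrite Rmult_0_r, Rplus_0_l in HF. exact HF.
Qed.
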